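(* Let $n\ge1$ and suppose $\alpha_{\boldsymbol N}(a,b)$ and $\beta_{\boldsymbol N}(a,b)$ form a WP Bailey pair with respect to the matrix $\mathbf B^{(3)}$. For complex parameters $\rho_1,\rho_2$ let \begin{align*} \alpha'_{\boldsymbol N}(a,b)&:=\frac{(\rho_1,\,\rho_2;q,p)_{|\boldsymbol N|}}{(aq/\rho_1,\,aq/\rho_2;q,p)_{|\boldsymbol N|}}\left(\frac{aq}{\rho_1\rho_2}\right)^{|\boldsymbol N|}\alpha_{\boldsymbol N}\big(a,b\rho_1\rho_2/(aq)\big),\\ \beta'_{\boldsymbol N}(a,b)&:=\frac{\prod_{r=1}^n(b\rho_1x_r/a,\,b\rho_2x_r/a;q,p)_{N_r}}{(aq/\rho_1,\,aq/\rho_2;q,p)_{|\boldsymbol N|}}\sum_{\substack{0\le k_r\le N_r\\ r=1,\dots,n}}\Bigg(\frac{(\rho_1,\,\rho_2;q,p)_{|\boldsymbol k|}}{\prod_{r=1}^n(b\rho_1x_r/a,\,b\rho_2x_r/a;q,p)_{k_r}}\\ &\quad\times\prod_{r=1}^n\frac{\theta(b\rho_1\rho_2x_rq^{k_r+|\boldsymbol k|}/(aq);p)}{\theta(b\rho_1\rho_2x_r/(aq);p)}\cdot\frac{(aq/(\rho_1\rho_2);q,p)_{|\boldsymbol N|-|\boldsymbol k|}}{\prod_{r,s=1}^n(q^{1+k_r-k_s}x_r/x_s;q,p)_{N_r-k_r}}\\ &\quad\times\prod_{r=1}^n\frac{(bx_r;q,p)_{k_r+|\boldsymbol N|}}{(b\rho_1\rho_2x_r/a;q,p)_{|\boldsymbol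 k|+N_r}}\cdot\left(\frac{aq}{\rho_1\rho_2}\right)^{|\boldsymbol k|}\beta_{\boldsymbol k}\big(a,b\rho_1\rho_2/(aq)\big)\Bigg). \end{align*} Then $\alpha'_{\boldsymbol N}(a,b)$ and $\beta'_{\boldsymbol N}(a,b)$ also form a WP Bailey pair with respect to $\mathbf B^{(3)}$.
   Context: Let $q,p$ be complex numbers with $q\neq 0$ and $|p|<1$. For $a\ne 0$ put $\theta(a;p)=\prod_{j\ge 0}(1-ap^j)(1-p^{j+1}/a)$. For an integer $k$ the $q,p$-shifted factorial is $(a;q,p)_k=\prod_{j=0}^{k-1}\theta(aq^j;p)$ if $k\ge 0$ (empty product $=1$), and $(a;q,p)_{k}=\big(\prod_{j=k}^{-1}\theta(aq^{j};p)\big)^{-1}$ if $k<0$. Write $(a_1,\dots,a_m;q,p)_k=(a_1;q,p)_k\cdots(a_m;q,p)_k$. For a tuple $\boldsymbol k=(k_1,\dots,k_n)$, $|\boldsymbol k|=k_1+\cdots+k_n$. The $x_1,\dots,x_n$ are fixed complex parameters. All parameters are nonzero and generic in the sense that no denominators vanish. WP Bailey pair: given a matrix $\mathbf B=(B_{\boldsymbol k\boldsymbol j}(a,b))$ indexed by $n$-tuples of nonnegative integers, two sequences $\alpha_{\boldsymbol N}(a,b)$ and $\beta_{\boldsymbol N}(a,b)$ (indexed by $n$-tuples of nonnegative integers and depending on parameters $a,b$) form a WP Bailey pair with respect to $\mathbf B$ if for all $\boldsymbol N$ and all (generic) $a,b$ $$\beta_{\boldsymbol N}(a,b)=\sum_{0\le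 j_r\le N_r,\ r=1,\dots,n}B_{\boldsymbol N\boldsymbol j}(a,b)\,\alpha_{\boldsymbol j}(a,b).$$ The matrix $\mathbf B^{(3)}$ has entries $$B^{(3)}_{\boldsymbol k\boldsymbol j}(a,b)=\frac{\prod_{r=1}^n(bx_r;q,p)_{j_r+|\boldsymbol k|}(bx_rq^{j_r-|\boldsymbol j|}/a;q,p)_{k_r-j_r}}{(aq;q,p)_{|\boldsymbol k|+|\boldsymbol j|}\prod_{r,s=1}^n(q^{1+j_r-j_s}x_r/x_s;q,p)_{k_r-j_r}}.$$ *)

(* Defs.v *)
From HB Require Import structures.
From mathcomp Require Import all_boot all_order all_algebra.
From mathcomp Require Import complex.
From mathcomp Require Import all_classical all_reals all_analysis.

Set Implicit Arguments.
Unset Strict Implicit.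
Unset Printing Implicit Defensive.

Import Order.TTheory GRing.Theory Num.Theory.
Import numFieldNormedType.Exports.

Local Open Scope ring_scope.
Local Open Scope complex_scope.

(* The modified theta function, an infinite product. The ascription to
   [R[i]^o] selects the topology given by the complex modulus. *)
Definition theta (R : realType) (p a : R[i]) : R[i] :=
  limn (fun m : nat =>
    (\prod_(j < m) ((1 - a * p ^+ j) * (1 - p ^+ j.+1 / a)) : R[i]^o)).

(* The q,p-shifted factorial (a; q, p)_k for k an integer. [Negz m] is
   -(m+1), and the substitution j = -(i+1) turns j = k, ..., -1 into
   i = m, ..., 0. *)
Definition qpfact (R : realType) (q p a : R[i]) (k : int) : R[i] :=
  match k with
  | Posz m => \prod_(j < m) theta p (a * q ^+ j)
  | Negz m => (\prod_(i < m.+1) theta p (a * q ^- i.+1))^-1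
  end.

(* (a_1, ..., a_m; q, p)_k *)
Definition qpfacts (R : realType) (q p : R[i]) (s : seq R[i]) (k : int) :
    R[i] :=
  \prod_(a <- s) qpfact q p a k.

Definition multi (n : nat) := {ffun 'I_n -> nat}.

Definition wt (n : nat) (k : multi n) : nat := (\sum_(r < n) k r)%N.

Definition lem (n : nat) (j k : multi n) : Prop := forall r, (j r <= k r)%N.

(* Sum of F j over all j with 0 <= j_r <= N_r for every r. *)
Definition box_sum (V : nmodType) (n : nat) (N : multi n) (F : multi n -> V) :
    V :=
  \sum_(j : {dffun forall r : 'I_n, 'I_(N r).+1}) F [ffun r => j r : nat].

(* Families indexed by multi-indices and depending on the parameters a, b. *)
Definition seq_ab (R : realType) (n : nat) := multi n -> R[i] -> R[i] -> R[i].
Definition matrix_ab (R : realType) (n : nat) :=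
  multi n -> multi n -> R[i] -> R[i] -> R[i].

(* WP Bailey pair with respect to B. The set G consists of the generic
   parameters (a, b), i.e., those for which no denominator vanishes, including
   any denominators that alpha and beta may have themselves. *)
Definition WP_Bailey_pair (R : realType) (n : nat) (B : matrix_ab R n)
    (G : R[i] -> R[i] -> Prop) (alpha beta : seq_ab R n) : Prop :=
  forall (N : multi n) (a b : R[i]), G a b ->
    beta N a b = box_sum N (fun j => B N j a b * alpha j a b).

Section B3.
Variables (R : realType) (n : nat) (q p : R[i]) (x : 'I_n -> R[i]).
Implicit Types (k j N : multi n) (a b c : R[i]).

Definition B3_num k j a b : R[i] :=
  \prod_(r < n)
    (qpfact q p (b * x r) (j r + wt k)%:Z *
     qpfact q p (b * x r * q ^ ((j r)%:Z - (wt j)%:Z) / a)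
       ((k r)%:Z - (j r)%:Z)).

Definition B3_den k j a : R[i] :=
  qpfact q p (a * q) (wt k + wt j)%:Z *
  \prod_(r < n) \prod_(s < n)
    qpfact q p (q ^ (1 + (j r)%:Z - (j s)%:Z) * x r / x s)
      ((k r)%:Z - (j r)%:Z).

Definition B3 : matrix_ab R n := fun k j a b => B3_num k j a b / B3_den k j a.

Definition B3_generic a b : Prop :=
  [/\ a != 0, b != 0 & forall k j, lem j k -> B3_den k j a != 0].

Section Transformed.
Variables (rho1 rho2 : R[i]).

Definition shift_b a b : R[i] := b * rho1 * rho2 / (a * q).

Definition outer_den N a : R[i] :=
  qpfacts q p [:: a * q / rho1; a * q / rho2] (wt N)%:Z.

Definition alpha' (alpha : seq_ab R n) : seq_ab R n := fun N a b =>
  qpfacts q p [:: rho1; rho2] (wt N)%:Z / outer_den N a *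
  (a * q / (rho1 * rho2)) ^+ wt N * alpha N a (shift_b a b).

(* The four denominators inside the sum defining beta'_N. *)
Definition beta'_den1 k a b : R[i] :=
  \prod_(r < n)
    qpfacts q p [:: b * rho1 * x r / a; b * rho2 * x r / a] (k r)%:Z.

Definition beta'_den2 a b : R[i] :=
  \prod_(r < n) theta p (b * rho1 * rho2 * x r / (a * q)).

Definition beta'_den3 N k : R[i] :=
  \prod_(r < n) \prod_(s < n)
    qpfact q p (q ^ (1 + (k r)%:Z - (k s)%:Z) * x r / x s)
      ((N r)%:Z - (k r)%:Z).

Definition beta'_den4 N k a b : R[i] :=
  \prod_(r < n)
    qpfact q p (b * rho1 * rho2 * x r / a) (wt k + N r)%:Z.

Definition beta' (beta : seq_ab R n) : seq_ab R n := fun N a b =>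
  (\prod_(r < n)
     qpfacts q p [:: b * rho1 * x r / a; b * rho2 * x r / a] (N r)%:Z) /
  outer_den N a *
  box_sum N (fun k =>
    qpfacts q p [:: rho1; rho2] (wt k)%:Z / beta'_den1 k a b *
    ((\prod_(r < n)
        theta p (b * rho1 * rho2 * x r * q ^+ (k r + wt k) / (a * q))) /
     beta'_den2 a b) *
    (qpfact q p (a * q / (rho1 * rho2)) ((wt N)%:Z - (wt k)%:Z) /
     beta'_den3 N k) *
    ((\prod_(r < n) qpfact q p (b * x r) (k r + wt N)%:Z) /
     beta'_den4 N k a b) *
    (a * q / (rho1 * rho2)) ^+ wt k * beta k a (shift_b a b)).

Definition transf_generic a b : Prop :=
  forall N k, lem k N ->
    [/\ outer_den N a != 0, beta'_den1 k a b != 0, beta'_den2 a b != 0,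
        beta'_den3 N k != 0 & beta'_den4 N k a b != 0].

End Transformed.
End B3.

(* Main.v *)
From HB Require Import structures.
From mathcomp Require Import all_boot all_order all_algebra.
From mathcomp Require Import ring zify.
Set Implicit Arguments.
Unset Strict Implicit.
Unset Printing Implicit Defensive.

Import Order.TTheory GRing.Theory Num.Theory.
Local Open Scope ring_scope.

(** Inserting the sum that defines [beta] into the one that defines [beta'] and
    exchanging the two finite sums reduces the theorem to a scalar identity: for
    fixed [j <= N], the sum over [j <= k <= N] of the coefficients of [alpha j]
    must be the coefficient prescribed by [B3] and [alpha'].  Up to factors that
    do not depend on [k] ([summand_box_term], [box_rhs_B3]) this is the elliptic
    Jackson summation of type A_n due to Rosengren, [box_sum_formula].

    That summation is first proved when all upper bounds are 1, as a sum over the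
    subsets of a finite set of variables ([subset_sum]).  The general case is a
    principal specialization: each variable [z r] is replaced by the string
    [z r], [z r * q], [z r * q ^+ 2], and so on, and a factor theta(1) = 0 kills
    every subset that is not a union of initial segments of the strings.

    The sum over subsets is evaluated by induction on the number [n] of
    variables.  Seen as a function of one variable and cleared of denominators,
    the difference of the two sides is a combination of products of [2 * n] theta
    functions with the same multiplier, so that it vanishes identically as soon as
    it vanishes at [2 * n] points ([theta_span_interp]).  The points are the poles
    [q ^- k], where the term of [I] cancels that of [x |: I] ([node_pole]); the
    other variables, where the terms cancel when [x] and the other variable are
    exchanged ([node_variable]); and the parameter [g], where the sum reduces to
    one with fewer variables ([node_param]).  The interpolation principle is the
    elliptic partial fraction identity [theta_partial_fractions], which follows
    from the three-term addition formula of Weierstrass.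

    Everything so far is algebra over a field, for a function with the four
    properties listed in [theta_like].  For the infinite product these are
    elementary except for the addition formula.  The finite form of the Jacobi
    triple product ([finite_triple_product]) gives
    [theta (x * y) * theta (x / y)] as the limit of a constant times
    [x * (G1 x * G0 y - G0 x * G1 y)], where [G0] and [G1] are truncations of two
    explicit series ([theta_det_tends]).  As the products are 2x2 determinants,
    the addition formula is the Pluecker relation between four vectors of the
    plane. *)

(** * Functions that behave like a theta function *)

(** What the proof needs to know about theta.  [th_quasi] is quasi-periodicity:
    a shift by a zero [c] multiplies [th] by a monomial, whose constant is tied to
    its exponent.  [th_addition] is the three-term formula of Weierstrass in a
    form without square roots. *)
Record theta_like (F : fieldType) (th : F -> F) : Prop := ThetaLike {
  th_one : th 1 = 0;
  th_inv : forall x, x != 0 -> th x^-1 = - (x^-1 * th x);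
  th_quasi : forall c, c != 0 -> th c = 0 ->
    exists phi (kappa : int), [/\ phi != 0, phi ^+ 2 = c ^ (kappa + 1) &
      forall x, x != 0 -> th (c * x) = phi * x ^ kappa * th x];
  th_addition : forall z b b' u v, z != 0 -> b != 0 -> b' != 0 -> u != 0 -> v != 0 ->
    th (z / b) * th (z / b') * th (u * v / (b * b')) * th (v / u) =
    th (z * u / (b * b')) * th (z / u) * th (v / b) * th (v / b') -
    v / u * th (u / b) * th (u / b') * th (z * v / (b * b')) * th (z / v) }.

Section ThetaLike.
Variables (F : fieldType) (th : F -> F).
Hypothesis thP : theta_like th.

Lemma th_swap x y : x != 0 -> y != 0 -> th (x / y) = - (x / y * th (y / x)).
Proof.
move=> x0 y0; rewrite -[y / x]invf_div (th_inv thP) ?mulf_neq0 ?invr_eq0 //.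
by rewrite mulrN opprK mulrA divff ?mul1r // mulf_neq0 ?invr_eq0.
Qed.

(** The zeros form a multiplicative group; this is what lets degenerate choices
    of parameters be avoided in the partial fraction identity. *)
Lemma th_div_eq0 x y : x != 0 -> y != 0 -> th x = 0 -> th y = 0 ->
  th (x / y) = 0.
Proof.
move=> x0 y0 tx ty; have [phi [k [_ _ ->]]] := th_quasi thP x0 tx; rewrite ?invr_eq0 //.
by rewrite (th_inv thP) // ty !mulr0 oppr0 mulr0.
Qed.

Lemma th_divC_eq0 x y : x != 0 -> y != 0 -> (th (x / y) == 0) = (th (y / x) == 0).
Proof.
move=> x0 y0; rewrite th_swap // oppr_eq0 !mulf_eq0 invr_eq0.
by rewrite (negPf x0) (negPf y0).
Qed.

Definition node_den (s : seq F) (a : F) : F := \prod_(a' <- s | a' != a) th (a / a').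

(** Nodes are lists of values: separated nodes are distinct, so that
    [a' != a] in [node_den] leaves out exactly one factor. *)
Definition separated (s : seq F) : Prop :=
  [/\ uniq s, 0 \notin s &
      {in s &, forall a a', a != a' -> th (a / a') != 0}].

Lemma separated_rem s w : separated s -> separated (rem w s).
Proof.
case=> us s0 sd; split; first exact: rem_uniq.
  by apply: contra s0; apply: mem_rem.
by move=> a a' /mem_rem ha /mem_rem ha'; apply: sd.
Qed.

Lemma node_den_neq0 s a : separated s -> a \in s -> node_den s a != 0.
Proof.
case=> us s0 sd ha; rewrite /node_den big_seq_cond prodf_seq_neq0.
apply/allP => a' ha'; apply/implyP => /andP[_ ne]; apply: sd => //.
by rewrite eq_sym.
Qed.

(** A numerator factor vanishing at the node [w] removes that node. *)
Lemma sum_rem_node s w (X : F -> F) : separated s -> w \in s ->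
  \sum_(a <- s) th (a / w) * X a / node_den s a =
  \sum_(a <- rem w s) X a / node_den (rem w s) a.
Proof.
move=> sp ws; have [us s0 sd] := sp.
have w0 : w != 0 by apply: contraNneq s0 => <-.
rewrite (perm_big _ (perm_to_rem ws)) /= big_cons divff // (th_one thP) !mul0r add0r.
rewrite big_seq [RHS]big_seq; apply: eq_bigr => a.
rewrite mem_rem_uniq // inE => /andP[aw ha].
rewrite [X in _ / X = _](_ : _ = th (a / w) * node_den (rem w s) a); last first.
  rewrite /node_den (perm_big _ (perm_to_rem ws)) /= big_cons.
  by rewrite eq_sym aw.
by rewrite -mulf_div divff ?mul1r //; apply: sd.
Qed.

(** By induction on the number of nodes: for two nodes [u] and [v], the addition
    formula writes two numerator factors as a combination of two products, one
    vanishing at [u] and the other at [v]; each part is a sum with one node less.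
    The coefficients are defined when theta does not vanish at
    [u * v / (b1 * b2)].  Among two candidates for [v] at least one is suitable,
    since two zeros would make the quotient of the candidates a zero as well. *)
Lemma theta_partial_fractions (s b : seq F) :
  separated s -> 0 \notin b -> size s = size b ->
  \prod_(a <- s) a = \prod_(be <- b) be ->
  \sum_(a <- s) (\prod_(be <- b) th (a / be)) / node_den s a = 0.
Proof.
have [m] := ubnP (size b); elim: m b s => // m IH [|b1 [|b2 b]] s sm sp.
- by move=> _ /eqP/nilP -> _; rewrite big_nil.
- case: s sp => [|a [|]] //= _; rewrite inE => b0 _.
  rewrite !big_cons !big_nil !mulr1 addr0 => ->.
  by rewrite divff 1?eq_sym // (th_one thP) mul0r.
case: s sp => [|u [|v1 [|v2 s]]] // sp.
  case: b sm => [|//] sm b0 _.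
  rewrite !big_cons !big_nil !mulr1 => e.
  have [us s0 sd] := sp.
  rewrite addr0 /node_den !big_cons !big_nil !eqxx /=.
  have uv : u != v1 by case/andP: us; rewrite inE.
  rewrite uv [v1 == u]eq_sym uv !mulr1.
  have /sd := uv; rewrite !inE !eqxx orbT => /(_ isT isT) duv.
  move: s0 b0; rewrite !inE !negb_or ![0 == _]eq_sym.
  case/andP=> u0 v0 /andP[b10 b20].
  have e2 : b2 = u * v1 / b1 by rewrite e mulrAC divff ?mul1r.
  have -> : u / b2 = b1 / v1 by rewrite e2; field; rewrite u0 v0 b10.
  have -> : v1 / b2 = b1 / u by rewrite e2; field; rewrite u0 v0 b10.
  rewrite (th_swap v0 b10) (th_swap b10 u0) (th_swap v0 u0).
  by field; rewrite ?b10 ?u0 ?v0 ?duv oppr_eq0 mulf_neq0.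
set S := [:: u, v1, v2 & s] in sp *.
move=> b0 sz pr.
have [us s0 sd] := sp.
have nz a : a \in S -> a != 0 by move=> aS; apply: contraNneq s0 => <-.
have uS : u \in S by rewrite !inE eqxx.
have v1S : v1 \in S by rewrite !inE eqxx orbT.
have v2S : v2 \in S by rewrite !inE eqxx !orbT.
move: b0; rewrite !inE !negb_or ![0 == _]eq_sym => /and3P[b10 b20 b0].
have u0 := nz _ uS.
(* A partner v of u for which the addition formula can be solved. *)
have [v [vS vu dv]] : exists v, [/\ v \in S, v != u & th (u * v / (b1 * b2)) != 0].
  have [e1|] := eqVneq (th (u * v1 / (b1 * b2))) 0; last first.
    move=> ne; exists v1; split=> //.
    by apply: contraTneq us => /= ->; rewrite inE eqxx.
  have [e2|] := eqVneq (th (u * v2 / (b1 * b2))) 0; last first.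
    move=> ne; exists v2; split=> //.
    by apply: contraTneq us => /= ->; rewrite !inE eqxx orbT.
  have v10 := nz _ v1S; have v20 := nz _ v2S.
  have v12 : v1 != v2.
    by apply: contraTneq us => /= ->; rewrite !inE eqxx /= andbF.
  have := sd _ _ v1S v2S v12.
  rewrite (_ : v1 / v2 = (u * v1 / (b1 * b2)) / (u * v2 / (b1 * b2))); last first.
    by field; rewrite b10 b20 u0 v20.
  by rewrite th_div_eq0 ?eqxx // !mulf_neq0 // invr_eq0 mulf_neq0.
have v0 := nz _ vS.
have duv := sd _ _ vS uS vu.
set c := b1 * b2 in dv.
have c0 : c != 0 by rewrite mulf_neq0.
pose K := th (v / b1) * th (v / b2) / (th (u * v / c) * th (v / u)).
pose L := - (v / u * th (u / b1) * th (u / b2)) / (th (u * v / c) * th (v / u)).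
pose X w a := th (a / (c / w)) * \prod_(be <- b) th (a / be).
have part w : w \in S -> \sum_(a <- S) th (a / w) * X w a / node_den S a = 0.
  move=> wS; rewrite sum_rem_node //.
  have w0 := nz _ wS.
  have IH' := IH (c / w :: b) (rem w S) _ (separated_rem w sp).
  rewrite -[RHS]IH' //; first last.
  - have := pr; rewrite (perm_big _ (perm_to_rem wS)) /= !big_cons.
    move=> e; apply: (mulfI w0); rewrite e /c; by field.
  - by have := sz; rewrite (perm_size (perm_to_rem wS)) => /eqP; rewrite !eqSS => /eqP.
  - rewrite inE negb_or b0 andbT eq_sym; apply: mulf_neq0 => //.
    by rewrite invr_eq0.
  by apply: eq_bigr => a _; rewrite /X big_cons.
rewrite (eq_big_seq (fun a => K * (th (a / u) * X u a / node_den S a) +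
                              L * (th (a / v) * X v a / node_den S a))); last first.
  move=> a aS; have a0 := nz _ aS; have da := node_den_neq0 sp aS.
  have := th_addition thP a0 b10 b20 u0 v0.
  rewrite !big_cons /K /L /X -/c (_ : a / (c / u) = a * u / c); last by rewrite invf_div mulrA.
  rewrite (_ : a / (c / v) = a * v / c); last by rewrite invf_div mulrA.
  set P := \prod_(_ <- b) _ => W.
  apply: (mulIf (mulf_neq0 dv duv)).
  transitivity (th (a / b1) * th (a / b2) * th (u * v / c) * th (v / u) * (P / node_den S a)).
    by ring.
  by rewrite W; field; rewrite u0 dv duv da.
by rewrite big_split /= -!mulr_sumr !part // !mulr0 addr0.
Qed.

(** Products of [d] theta factors, the analogue of polynomials split into linear
    factors.  All such products with the same [nu] have the same
    multiplier under a shift, so that [theta_span d nu] is a space of theta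
    functions. *)
Definition theta_mon (d : nat) (nu : F) (f : F -> F) : Prop :=
  exists ka (B : seq F), [/\ size B = d, \prod_(be <- B) be = nu, 0 \notin B &
    forall z, z != 0 -> f z = ka * \prod_(be <- B) th (z / be)].

Inductive theta_span (d : nat) (nu : F) : (F -> F) -> Prop :=
| theta_span_mon f : theta_mon d nu f -> theta_span d nu f
| theta_span0 : theta_span d nu (fun=> 0)
| theta_spanD f g : theta_span d nu f -> theta_span d nu g ->
    theta_span d nu (fun z => f z + g z).

Lemma theta_span_sum d nu (I : finType) (P : pred I) (f : I -> F -> F) :
  (forall i, P i -> theta_span d nu (f i)) ->
  exists2 g, theta_span d nu g & forall z, g z = \sum_(i | P i) f i z.
Proof.
move=> sf.
elim: (index_enum I) => [|i r [g sg eg]].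
  by exists (fun=> 0); [exact: theta_span0 | move=> z; rewrite big_nil].
have [Pi|nPi] := boolP (P i).
  exists (fun z => f i z + g z); first by apply: theta_spanD => //; apply: sf.
  by move=> z; rewrite big_cons Pi eg.
by exists g => // z; rewrite big_cons (negPf nPi) eg.
Qed.

(** The multiplier depends on [f] through [d] and [nu] only. *)
Lemma theta_span_quasi d nu c : c != 0 -> th c = 0 ->
  forall z, z != 0 -> exists m, forall f, theta_span d nu f -> f (c * z) = m * f z.
Proof.
move=> c0 tc z z0; have [phi [k [phi0 _ Q]]] := th_quasi thP c0 tc.
exists (phi ^+ d * z ^ (k * d%:Z) * nu ^ (- k)) => f.
elim=> {f} [f [ka [B [sB pB B0 ef]]]||f g _ ef _ eg]; first last.
- by rewrite ef eg mulrDr.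
- by rewrite mulr0.
rewrite !ef ?mulf_neq0 // mulrCA; congr (_ * _).
rewrite -{}sB -{}pB {ef}; elim: B B0 => [|be B IH].
  by rewrite !big_nil mulr0 !expr0z exp1rz !mulr1.
rewrite inE negb_or eq_sym => /andP[be0 B0].
rewrite !big_cons -mulrA Q ?mulf_neq0 ?invr_eq0 // IH //.
rewrite exprS !expfzMl ?exprz_inv.
rewrite (_ : (size (be :: B))%:Z = 1 + (size B)%:Z) //.
by rewrite mulrDr mulr1 expfzDr //; ring.
Qed.

(** The analogue of the fact that a polynomial with too many roots is zero.
    Partial fractions with the nodes [z :: s] express [f z] through the values
    on [s]; the extra zero [bs] makes the product condition hold.  The argument
    needs [z] to be separated from [s], and quasi-periodicity covers the rest. *)
Lemma theta_span_interp d nu (s : seq F) f : theta_span d nu f ->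
  separated s -> size s = d -> nu != 0 -> th (nu / \prod_(a <- s) a) != 0 ->
  {in s, forall a, f a = 0} -> forall z, z != 0 -> f z = 0.
Proof.
move=> sf sp sz nu0 tnu fs z z0.
have [us s0 sd] := sp.
have nz a : a \in s -> a != 0 by move=> aS; apply: contraNneq s0 => <-.
have [/hasP[a aS /eqP ta]|/hasPn zs] := boolP (has (fun a => th (z / a) == 0) s).
  have a0 := nz _ aS.
  have [|m em] := @theta_span_quasi d nu (z / a) _ ta a a0.
    by rewrite mulf_neq0 ?invr_eq0.
  by rewrite -[z](divfK a0) em // fs // mulr0.
have spz : separated (z :: s).
  split.
  - rewrite /= us andbT; apply/negP => /[dup] /zs; rewrite divff //.
    by rewrite (th_one thP) eqxx.
  - by rewrite inE negb_or eq_sym z0.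
  move=> a a'; rewrite !inE => /predU1P[->|aS] /predU1P[->|a'S]; rewrite ?eqxx //.
  - by move=> _; apply: zs.
  - by move=> _; rewrite th_divC_eq0; [exact: zs | exact: nz | exact: z0].
  - exact: sd.
have p0 : \prod_(a <- s) a != 0.
  by rewrite prodf_seq_neq0; apply/allP => a /nz ->.
pose bs := z * \prod_(a <- s) a / nu.
have bs0 : bs != 0 by rewrite !mulf_neq0 ?invr_eq0.
suff: \sum_(a <- z :: s) f a * th (a / bs) / node_den (z :: s) a = 0.
  rewrite big_cons big_seq big1 ?addr0; last by move=> a aS; rewrite fs // !mul0r.
  have -> : z / bs = nu / \prod_(a <- s) a by rewrite /bs; field; rewrite z0 p0 nu0.
  move/eqP; rewrite !mulf_eq0 (negPf tnu) invr_eq0.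
  by rewrite (negPf (node_den_neq0 spz _)) ?inE ?eqxx ?orbF // => /eqP.
elim: {fs} sf => {f} [f [ka [B [sB pB B0 ef]]]||f g _ ef _ eg]; first last.
- rewrite (eq_bigr (fun a => f a * th (a / bs) / node_den (z :: s) a + g a * th (a / bs) /
    node_den (z :: s) a)); last by move=> a _; rewrite -!mulrDl.
  by rewrite big_split /= ef eg addr0.
- by rewrite big1 // => a _; rewrite !mul0r.
transitivity (ka * \sum_(a <- z :: s) (\prod_(be <- bs :: B) th (a / be)) / node_den (z ::
    s) a).
  rewrite mulr_sumr; apply: eq_big_seq => a aS.
  have a0 : a != 0 by move: aS; rewrite inE => /predU1P[->|/nz].
  by rewrite ef // big_cons; ring.
rewrite theta_partial_fractions ?mulr0 //.
- by rewrite inE negb_or eq_sym bs0.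
- by rewrite /= sz sB.
- by rewrite !big_cons pB /bs mulfVK.
Qed.

Lemma separated_pairwise s : 0 \notin s ->
  pairwise (fun a a' => th (a / a') != 0) s -> separated s.
Proof.
elim: s => [|a s IH] //; rewrite inE negb_or eq_sym => /andP[a0 s0] /=.
case/andP=> /allP da ps; have [us _ sd] := IH s0 ps.
split; last 1 first.
- move=> x y; rewrite !inE => /predU1P[->|xs] /predU1P[->|ys]; rewrite ?eqxx //.
  + by move=> _; apply: da.
  + by move=> _; rewrite th_divC_eq0 ?da //; apply: contraNneq s0 => <-.
  + exact: sd.
- rewrite /= us andbT; apply/negP => /da.
  by rewrite divff // (th_one thP) eqxx.
- by rewrite inE negb_or eq_sym a0.
Qed.

Lemma theta_mon_const ka : theta_mon 0 1 (fun=> ka).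
Proof. by exists ka, [::]; split=> // [|z _]; rewrite big_nil ?mulr1. Qed.

Lemma theta_mon_th be : be != 0 -> theta_mon 1 be (fun z => th (z / be)).
Proof.
move=> be0; exists 1, [:: be]; split=> //; first by rewrite big_seq1.
  by rewrite inE eq_sym.
by move=> z _; rewrite big_seq1 mul1r.
Qed.

Lemma theta_monM d1 d2 nu1 nu2 f1 f2 : theta_mon d1 nu1 f1 ->
  theta_mon d2 nu2 f2 -> theta_mon (d1 + d2) (nu1 * nu2) (fun z => f1 z * f2 z).
Proof.
case=> k1 [B1 [s1 p1 z1 e1]] [k2 [B2 [s2 p2 z2 e2]]].
exists (k1 * k2), (B1 ++ B2); split.
- by rewrite size_cat s1 s2.
- by rewrite big_cat p1 p2.
- by rewrite mem_cat negb_or z1.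
- by move=> z z0; rewrite e1 // e2 // big_cat /= mulrACA.
Qed.

Lemma theta_mon_prod (I : finType) (A : {set I}) (be : I -> F) :
  {in A, forall i, be i != 0} ->
  theta_mon #|A| (\prod_(i in A) be i) (fun z => \prod_(i in A) th (z / be i)).
Proof.
move=> be0; exists 1, [seq be i | i <- enum A]; split.
- by rewrite size_map cardE.
- by rewrite big_map big_enum.
- by apply/mapP => -[i]; rewrite mem_enum => /be0/eqP h /esym.
- by move=> z _; rewrite big_map big_enum mul1r.
Qed.

Lemma eq_theta_mon d nu f d' nu' f' : theta_mon d nu f -> d = d' -> nu = nu' ->
  (forall z, z != 0 -> f z = f' z) -> theta_mon d' nu' f'.
Proof.
case=> k [B [sB pB zB eB]] <- <- e; exists k, B; split=> // z z0.
by rewrite -e // eB.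
Qed.

(** * The Jackson summation over subsets *)

Section SubsetSum.
Variables (q : F) (q0 : q != 0).

(** The shifted factorial [(a; q, p)_k] for a nonnegative index. *)
Definition qf (a : F) (k : nat) : F := \prod_(i < k) th (a * q ^+ i).

Lemma qf0 a : qf a 0 = 1. Proof. exact: big_ord0. Qed.

Lemma qfD a k l : qf a (k + l) = qf a k * qf (a * q ^+ k) l.
Proof.
rewrite /qf big_split_ord /=; congr (_ * _); apply: eq_bigr => i _.
by rewrite exprD mulrA.
Qed.

Lemma qfS a k : qf a k.+1 = th a * qf (a * q) k.
Proof. by rewrite -add1n qfD expr1 /qf big_ord1 mulr1. Qed.

Lemma qfSr a k : qf a k.+1 = qf a k * th (a * q ^+ k).
Proof. by rewrite -addn1 qfD {2}/qf big_ord1 mulr1. Qed.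

Lemma qf_neq0 a k : (forall i, (i < k)%N -> th (a * q ^+ i) != 0) -> qf a k != 0.
Proof. by move=> h; apply/prodf_neq0 => i _; apply: h. Qed.

Variables (T : finType) (Z : T -> F) (b c d : F).
Hypotheses (b0 : b != 0) (c0 : c != 0) (d0 : d != 0).

(** The parameters are constrained by [g = f * b * c] and by
    [d * q = f * q ^+ n], where [n] is the number of variables; the latter is the
    balancing condition. *)
Definition subset_coef (f g : F) (n k : nat) : F :=
  qf b k * qf c k * qf (g * q ^+ k) (n - k) * qf f (n - k) * f ^+ k.

Definition in_weight (g : F) (k : nat) (z : F) : F :=
  th (z * d) * th (z / g) / th (z * q ^+ k / q).

Definition out_weight (k : nat) (z : F) : F :=
  th (z / b) * th (z / c) / th (z * q ^+ k).

Definition cross_weight (U I : {set T}) : F :=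
  \prod_(r in U :\: I) \prod_(s in I) (th (q * Z r / Z s) / th (Z r / Z s)).

(** The term of [I] in a sum over the subsets of [V], with the sizes [n] of the
    set and [k] of the subset as independent arguments: the factors of a term
    that involve the variables in [V] are needed when [V] is a part of the whole
    set. *)
Definition part_term (f g : F) (n k : nat) (V I : {set T}) : F :=
  subset_coef f g n k * \prod_(i in I) in_weight g k (Z i) *
  \prod_(i in V :\: I) out_weight k (Z i) * cross_weight V I.

Definition subset_term (f g : F) (U I : {set T}) : F :=
  part_term f g #|U| #|I| U I.

Lemma sum_subsetsD1 (x : T) (U : {set T}) (G : {set T} -> F) : x \in U ->
  \sum_(I : {set T} | I \subset U) G I =
  \sum_(I : {set T} | I \subset U :\ x) (G I + G (x |: I)).
Proof.
move=> xU; rewrite (bigID (fun I : {set T} => x \notin I)) /= big_split /=.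
congr (_ + _); first by apply: eq_bigl => I; rewrite subsetD1.
rewrite (reindex_onto (fun I => x |: I) (fun I => I :\ x)) /=; last first.
  by move=> I /andP[_]; rewrite negbK => /setD1K.
apply: eq_bigl => I; rewrite setU11 subUset sub1set xU subsetD1 andbT /=.
congr andb; apply/eqP/idP => [<-|xI]; first by rewrite !inE eqxx.
by rewrite setU1K.
Qed.

Lemma setD1U (x : T) (U I : {set T}) : x \in U -> I \subset U :\ x ->
  U :\: I = x |: ((U :\ x) :\: I).
Proof.
move=> xU; rewrite subsetD1 => /andP[_ xI]; apply/setP => i; rewrite !inE.
by case: eqVneq => [->|]; rewrite ?xU ?xI.
Qed.

Lemma setDU1 (x : T) (U I : {set T}) : U :\: (x |: I) = (U :\ x) :\: I.
Proof. by apply/setP => i; rewrite !inE negb_or andbA [_ && (i != x)]andbC. Qed.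

Lemma part_term_out f g n k x (U I : {set T}) : x \in U -> I \subset U :\ x ->
  part_term f g n k U I = part_term f g n k (U :\ x) I *
    (out_weight k (Z x) *
     \prod_(s in I) (th (q * Z x / Z s) / th (Z x / Z s))).
Proof.
move=> xU IU; rewrite /part_term /cross_weight (setD1U xU IU).
rewrite !big_setU1 /= ?inE ?eqxx ?andbF //; ring.
Qed.

Lemma part_term_in f g n k x (U I : {set T}) : x \in U -> I \subset U :\ x ->
  part_term f g n k U (x |: I) = part_term f g n k (U :\ x) I *
    (in_weight g k (Z x) *
     \prod_(r in (U :\ x) :\: I) (th (q * Z r / Z x) / th (Z r / Z x))).
Proof.
move=> xU IU; have xI : x \notin I by move: IU; rewrite subsetD1 => /andP[].
rewrite /part_term /cross_weight setDU1.
have -> : \prod_(r in (U :\ x) :\: I) \prod_(s in x |: I) (th (q * Z r / Z s) / th (Z r / Z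
    s)) =
  \prod_(r in (U :\ x) :\: I) (th (q * Z r / Z x) / th (Z r / Z x)) *
  \prod_(r in (U :\ x) :\: I) \prod_(s in I) (th (q * Z r / Z s) / th (Z r / Z s)).
  by rewrite -big_split /=; apply: eq_bigr => r _; rewrite big_setU1.
by rewrite big_setU1 //=; ring.
Qed.

(** The conditions on [Z] say that no denominator vanishes; those on [g] and [q]
    make [g] and the poles [q ^- k] usable as nodes of the interpolation. *)
Definition subset_generic (g : F) (U : {set T}) : Prop :=
  [/\ {in U, forall i, Z i != 0},
      {in U &, forall i j, i != j -> th (Z i / Z j) != 0},
      {in U, forall i k, (k < #|U|)%N -> th (Z i * q ^+ k) != 0},
      forall k, (k < #|U|)%N -> th (g * q ^+ k) != 0 &
      forall k, (0 < k < #|U|)%N -> th (q ^+ k) != 0].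

Definition subset_rhs (g : F) (U : {set T}) : F :=
  qf (g / b) #|U| * qf (g / c) #|U| * \prod_(i in U) th (Z i / (b * c)).

(** If [f] is a zero of theta, the factor [qf f (n - k)] leaves only the term of
    the whole set.  The identity is then a consequence of quasi-periodicity under
    multiplication by [f]. *)
Lemma subset_sum_degenerate f g (U : {set T}) : subset_generic g U ->
  f != 0 -> g = f * b * c -> d * q = f * q ^+ #|U| -> th f = 0 ->
  \sum_(I : {set T} | I \subset U) subset_term f g U I = subset_rhs g U.
Proof.
move=> [Z0 _ ZP _ _] f0 gE dE tf.
have g0 : g != 0 by rewrite gE !mulf_neq0.
rewrite (bigD1 U) //= [X in _ + X]big1 ?addr0; last first.
  move=> I; rewrite andbC -properEneq => pr.
  have := proper_card pr; rewrite -subn_gt0 /subset_term /part_term /subset_coef.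
  by case: (_ - _)%N => // k _; rewrite [qf f _]qfS tf !(mul0r, mulr0).
have [phi [ka [phi0 phiE Q]]] := th_quasi thP f0 tf.
rewrite /subset_term /part_term /subset_coef /cross_weight setDv !big_set0.
rewrite !mulr1 subnn !qf0 !mulr1 /subset_rhs.
set n := #|U|.
have -> : g / b = f * c by rewrite gE; field.
have -> : g / c = f * b by rewrite gE; field.
have qfQ a : a != 0 -> qf (f * a) n = qf a n * \prod_(i < n) (phi * (a * q ^+ i) ^ ka).
  move=> a0; rewrite /qf -big_split /=; apply: eq_bigr => i _.
  by rewrite -mulrA Q ?mulf_neq0 ?expf_neq0 // mulrC.
rewrite !qfQ // -[RHS]mulrA -[LHS]mulrA.
have zin i : i \in U -> in_weight g n (Z i) =
    th (Z i / (b * c)) * (f * b * c * (q ^+ n / q)) ^ ka.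
  move=> iU; have zi := Z0 _ iU; have [qn0 y0] : q ^+ n != 0 /\ Z i * q ^+ n / q != 0.
    by rewrite !mulf_neq0 ?invr_eq0 ?expf_neq0.
  rewrite /in_weight (_ : Z i * d = f * (Z i * q ^+ n / q)); last first.
    by rewrite (_ : d = f * q ^+ n / q); [ring | rewrite -dE mulfK].
  rewrite (_ : Z i / (b * c) = f * (Z i / g)); last by rewrite gE; field; rewrite b0 c0 f0.
  rewrite !Q // ?mulf_neq0 ?invr_eq0 //.
  have n0 : (0 < n)%N by apply/card_gt0P; exists i.
  have ty : th (Z i * q ^+ n / q) != 0.
    rewrite -(prednK n0) exprSr mulrA mulfK //; apply: ZP => //.
    by rewrite prednK.
  rewrite (_ : Z i * q ^+ n / q = (Z i / g) * (f * b * c * (q ^+ n / q))); last first.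
    by rewrite gE; field; rewrite q0 f0 b0 c0.
  rewrite [((_ / g) * _) ^ ka]expfzMl (_ : Z i / g * (f * b * c * (q ^+ n / q)) = Z i * q
      ^+ n / q); last first.
    by rewrite gE; field; rewrite q0 f0 b0 c0.
  by field.
rewrite (eq_bigr _ zin) big_split /= prodr_const -/n.
(* Pairing q^i with q^(n-1-i) makes all factors equal. *)
rewrite [\prod_(i < n) (phi * (c * _) ^ ka)](reindex_inj rev_ord_inj) /=.
set A := \prod_(i in U) _.
suff E : \prod_(j < n) (phi * (c * q ^+ (n - j.+1)) ^ ka) * \prod_(i < n) (phi * (b * q ^+
    i) ^ ka)
     = f ^+ n * ((f * b * c * (q ^+ n / q)) ^ ka) ^+ n.
  transitivity (qf b n * qf c n * A * (f ^+ n * ((f * b * c * (q ^+ n / q)) ^ ka) ^+ n)).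
    by ring.
  by rewrite -E; ring.
rewrite -exprMn -big_split /= [RHS](_ : _ = \prod_(i < n) (f * (f * b * c * (q ^+ n / q)) ^
    ka)); last first.
  by rewrite prodr_const card_ord.
apply: eq_bigr => i _.
rewrite mulrACA -expr2 phiE -expfzMl.
have -> : c * q ^+ (n - i.+1) * (b * q ^+ i) = b * c * (q ^+ n / q).
  have -> : q ^+ n / q = q ^+ (n - i.+1) * q ^+ i.
    by apply: (mulIf q0); rewrite divfK // -mulrA -exprSr -exprD subnK.
  by ring.
rewrite -!mulrA [(f * _) ^ ka]expfzMl expfzDr // expr1z; ring.
Qed.

Definition other_poles (n k : nat) (z : F) : F :=
  \prod_(l < n | l != k :> nat) th (z * q ^+ l).

Lemma qf_other_poles n k z : (k < n)%N -> qf z n = th (z * q ^+ k) * other_poles n k z.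
Proof. by move=> kn; rewrite /qf (bigD1 (Ordinal kn)). Qed.

(** Let [z] be the value of the variable [x] and let [V] be the set of the other
    variables.  After multiplication by the common denominator, whose zeros are
    the [Z s] for [s] in [V] and the [q ^- l] for [l < n], the terms of [I] and of
    [x |: I] depend on [z] through [num_out] and [num_in] respectively. *)
Definition num_out (n k : nat) (V I : {set T}) (z : F) : F :=
  th (z / b) * th (z / c) * \prod_(s in I) th (z / (Z s / q)) *
  \prod_(r in V :\: I) th (z / Z r) * other_poles n k z.

Definition num_in (g : F) (n k : nat) (V I : {set T}) (z : F) : F :=
  th (z * d) * th (z / g) * (q ^+ #|V :\: I| * \prod_(r in V :\: I) th (z / (q * Z r))) *
  \prod_(s in I) th (z / Z s) * other_poles n k z.

Definition cofactor_sum (f g : F) (n : nat) (V : {set T}) (z : F) : F :=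
  \sum_(I : {set T} | I \subset V)
    (part_term f g n #|I| V I * num_out n #|I| V I z +
     part_term f g n #|I|.+1 V I * num_in g n #|I| V I z).

Lemma other_poles_mon n k : (k < n)%N ->
  theta_mon n.-1 (\prod_(l < n | l != k :> nat) q ^- l) (other_poles n k).
Proof.
move=> kn; pose A := [set l : 'I_n | l != k :> nat].
have HA : {in A, forall l : 'I_n, q ^- l != 0} by move=> l _; rewrite invr_eq0 expf_neq0.
apply: (eq_theta_mon (theta_mon_prod HA)).
- rewrite -[n in RHS]card_ord -(cardC1 (Ordinal kn)).
  by apply: eq_card => l; rewrite !inE.
- by apply: eq_bigl => l; rewrite inE.
by move=> z _; apply: eq_big => l; rewrite ?inE ?invrK.
Qed.

Lemma inv_poles n k : (k < n)%N ->
  \prod_(l < n) q ^- l = q ^- k * \prod_(l < n | l != k :> nat) q ^- l.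
Proof. by move=> kn; rewrite (bigD1 (Ordinal kn)). Qed.

Lemma prod_setD (V I : {set T}) (h : T -> F) : I \subset V ->
  \prod_(i in V) h i = \prod_(i in I) h i * \prod_(i in V :\: I) h i.
Proof.
move=> IV; rewrite (big_setID I) /=; congr (_ * _).
by apply: eq_bigl => i; rewrite (setIidPr IV).
Qed.

Lemma num_out_mon n (V I : {set T}) : I \subset V -> #|V|.+1 = n ->
  {in V, forall i, Z i != 0} ->
  theta_mon (n + n) (b * c * (\prod_(i in V) Z i * \prod_(l < n) q ^- l))
    (num_out n #|I| V I).
Proof.
move=> IV nE Z0; have In : (#|I| < n)%N by rewrite -nE ltnS subset_leq_card.
have HI : {in I, forall s, Z s / q != 0}.
  by move=> s /(subsetP IV) /Z0 zs; rewrite mulf_neq0 ?invr_eq0.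
have HV : {in V :\: I, forall s, Z s != 0}.
  by move=> s /setDP[/Z0].
apply: (eq_theta_mon (theta_monM (theta_monM (theta_monM (theta_monM (theta_mon_th b0)
  (theta_mon_th c0)) (theta_mon_prod HI)) (theta_mon_prod HV))
  (other_poles_mon In))) => //.
- have := cardsID I V; rewrite (setIidPr IV) => e; rewrite -nE /=; lia.
rewrite (prod_setD _ IV) (inv_poles In) big_split /= prodr_const exprVn.
by field; rewrite expf_neq0.
Qed.

Lemma num_in_mon f g n (V I : {set T}) : I \subset V -> #|V|.+1 = n ->
  g != 0 -> f != 0 -> g = f * b * c -> d * q = f * q ^+ n ->
  {in V, forall i, Z i != 0} ->
  theta_mon (n + n) (b * c * (\prod_(i in V) Z i * \prod_(l < n) q ^- l))
    (num_in g n #|I| V I).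
Proof.
move=> IV nE g0 f0 gE dE Z0.
have In : (#|I| < n)%N by rewrite -nE ltnS subset_leq_card.
have HI : {in I, forall s, Z s != 0} by move=> s /(subsetP IV) /Z0.
have HV : {in V :\: I, forall s, q * Z s != 0}.
  by move=> s /setDP[/Z0 zs _]; rewrite mulf_neq0.
have di0 : d^-1 != 0 by rewrite invr_eq0.
have eV := cardsID I V; rewrite (setIidPr IV) in eV.
apply: (eq_theta_mon (theta_monM (theta_monM (theta_monM (theta_monM (theta_mon_th di0)
  (theta_mon_th g0)) (theta_monM (theta_mon_const (q ^+ #|V :\: I|))
  (theta_mon_prod HV)))
  (theta_mon_prod HI)) (other_poles_mon In))) => //.
- rewrite -nE /=; lia.
- rewrite (prod_setD _ IV) (inv_poles In) big_split /= prodr_const mul1r.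
  have -> : d^-1 = q / (f * q ^+ n) by rewrite -dE; field; rewrite d0 q0.
  rewrite -nE -eV exprS exprD gE.
  by field; rewrite !expf_neq0 // q0 f0.
by move=> z z0; rewrite /num_in invrK.
Qed.

Lemma num_rhs_mon n (V : {set T}) : #|V|.+1 = n ->
  {in V, forall i, Z i != 0} ->
  theta_mon (n + n) (b * c * (\prod_(i in V) Z i * \prod_(l < n) q ^- l))
    (fun z => th (z / (b * c)) * \prod_(s in V) th (z / Z s) * qf z n).
Proof.
move=> nE Z0; have bc0 : b * c != 0 by rewrite mulf_neq0.
have HV : {in V, forall s, Z s != 0} by [].
have Hq : {in [set: 'I_n], forall l : 'I_n, q ^- l != 0}.
  by move=> l _; rewrite invr_eq0 expf_neq0.
apply: (eq_theta_mon (theta_monM (theta_monM (theta_mon_th bc0) (theta_mon_prod HV))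
  (theta_mon_prod Hq))) => //.
- by rewrite cardsT card_ord -nE /=; lia.
- by rewrite -mulrA; congr (_ * (_ * _)); apply: eq_bigl => l; rewrite inE.
by move=> z z0; congr (_ * _); apply: eq_big => l; rewrite ?inE ?invrK.
Qed.

(** At [z = q ^- k] only the subsets [I] of size [k] contribute: for the others a
    factor of [other_poles] vanishes.  Both terms contain [th (z * q ^+ k)] in
    the denominator, and their residues are opposite. *)
Lemma node_pole f g n (V I : {set T}) : I \subset V -> #|V|.+1 = n ->
  f != 0 -> g = f * b * c -> d * q = f * q ^+ n ->
  {in V, forall i, Z i != 0} ->
  {in V, forall i k, (k < n)%N -> th (Z i * q ^+ k) != 0} ->
  forall m, (m < n)%N ->
  part_term f g n #|I| V I * num_out n #|I| V I (q ^- m) +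
  part_term f g n #|I|.+1 V I * num_in g n #|I| V I (q ^- m) = 0.
Proof.
move=> IV nE f0 gE dE Z0 ZP m mn; set k := #|I|.
have kn : (k < n)%N by rewrite -nE ltnS subset_leq_card.
have [mk|mk] := eqVneq m k; last first.
  have z0 : other_poles n k (q ^- m) = 0.
    rewrite /other_poles (bigD1 (Ordinal mn)) //=.
    by rewrite mulVf ?expf_neq0 // (th_one thP) mul0r.
  by rewrite /num_out /num_in z0 !mulr0 addr0.
rewrite {}mk {m mn}; set z := q ^- k.
have g0 : g != 0 by rewrite gE !mulf_neq0.
have qk0 : q ^+ k != 0 by rewrite expf_neq0.
have thz y : y != 0 -> th (z / y) = - ((y * q ^+ k)^-1 * th (y * q ^+ k)).
  move=> y0; rewrite -(th_inv thP) ?mulf_neq0 //; congr (th _).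
  by rewrite /z; field; rewrite qk0 y0.
(* Q is the product common to both terms. *)
pose Q := \prod_(i in I) (- (th (Z i * d) * th (Z i / g) / (Z i * q ^+ k))) *
  \prod_(i in V :\: I) (- (th (Z i / b) * th (Z i / c) / (Z i * q ^+ k))) * cross_weight V I.
have HI i : i \in I -> [/\ Z i != 0, th (Z i * q ^+ k / q) != 0 & th (Z i * q ^+ k) != 0].
  move=> iI; have iV := subsetP IV _ iI; split; [exact: Z0| |exact: ZP].
  have k0 : (0 < k)%N by apply/card_gt0P; exists i.
  rewrite -(prednK k0) exprSr mulrA mulfK //; apply: ZP => //.
  by rewrite prednK // ltnW.
have HV i : i \in V :\: I -> [/\ Z i != 0, th (Z i * q ^+ k) != 0 & th (Z i * q ^+ k.+1) != 0].
  move=> iV; have kn1 : (k.+1 < n)%N.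
    rewrite -nE ltnS -/(_ < _)%N; apply: proper_card; rewrite properE IV.
    by case/setDP: iV => iV /negP nI; apply/negP => /subsetP/(_ _ iV).
  by case/setDP: iV => iV _; split; [exact: Z0 | exact: ZP | exact: ZP].
have E1 : part_term f g n k V I * num_out n k V I z =
   subset_coef f g n k * (th (z / b) * th (z / c)) * (q ^+ k * Q * other_poles n k z).
  rewrite /part_term /num_out.
  have -> : q ^+ k * Q = (\prod_(i in I) in_weight g k (Z i) * \prod_(s in I) th (z / (Z s
      / q))) *
     (\prod_(i in V :\: I) out_weight k (Z i) * \prod_(r in V :\: I) th (z / Z r)) *
         cross_weight V I.
    rewrite -!big_split /= /Q !mulrA -{1}prodr_const -big_split /=.
    congr (_ * _ * _); apply: eq_bigr => i iI.
      have [zi d1 d2] := HI _ iI; rewrite thz ?mulf_neq0 ?invr_eq0 // /in_weight.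
      have -> : Z i / q * q ^+ k = Z i * q ^+ k / q by rewrite mulrAC.
      by field; rewrite zi qk0 d1 q0.
    have [zi d1 d2] := HV _ iI; rewrite thz // /out_weight.
    by field; rewrite zi qk0 d1.
  ring.
have E2 : part_term f g n k.+1 V I * num_in g n k V I z =
   subset_coef f g n k.+1 * (th (z * d) * th (z / g)) * (Q * other_poles n k z).
  rewrite /part_term /num_in.
  have -> : Q = (\prod_(i in I) in_weight g k.+1 (Z i) * \prod_(s in I) th (z / Z s)) *
     (q ^+ #|V :\: I| * (\prod_(i in V :\: I) out_weight k.+1 (Z i) * \prod_(r in V :\: I)
         th (z / (q * Z r)))) * cross_weight V I.
    rewrite -prodr_const -!big_split /= /Q.
    congr (_ * _ * _); apply: eq_bigr => i iI.
      have [zi d1 d2] := HI _ iI; rewrite thz // /in_weight.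
      rewrite exprSr mulrA mulfK //.
      by field; rewrite zi qk0 d2.
    have [zi d1 d2] := HV _ iI; rewrite thz ?mulf_neq0 // /out_weight.
    have -> : q * Z i * q ^+ k = Z i * q ^+ k.+1 by rewrite exprS; ring.
    by rewrite exprS; field; rewrite -exprS zi qk0 d2 q0.
  ring.
rewrite {}E1 {}E2 /subset_coef.
have nk : (n - k = (n - k.+1).+1)%N by rewrite subnSK.
rewrite nk qfS (qfSr f) (qfSr b) (qfSr c) [f ^+ k.+1]exprSr [q ^+ k.+1]exprSr [g * (_ *
    _)]mulrA.
have -> : z * d = f * q ^+ (n - k.+1).
  apply: (mulIf q0); rewrite -mulrA dE -[in LHS](subnK kn) exprD exprSr /z.
  by field.
rewrite !thz // (_ : f ^+ k * f = f ^+ k * (g / (b * c))); last first.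
  by rewrite gE; field; rewrite b0 c0.
by field; rewrite b0 c0 qk0 g0.
Qed.

Lemma prod_eq0 (A : {set T}) (h : T -> F) x : x \in A -> h x = 0 ->
  \prod_(i in A) h i = 0.
Proof. by move=> xA hx; rewrite (bigD1 x) //= hx mul0r. Qed.

(** For [z = Z x], the terms of [x |: J] without the distinguished variable and
    of [J] with it are exchanged when the two variables are swapped; they
    cancel because their poles at [z = Z x] have opposite residues. *)
Lemma node_variable f g n (V : {set T}) x : #|V|.+1 = n -> g != 0 -> x \in V ->
  {in V, forall i, Z i != 0} ->
  {in V &, forall i j, i != j -> th (Z i / Z j) != 0} ->
  {in V, forall i k, (k < n)%N -> th (Z i * q ^+ k) != 0} ->
  cofactor_sum f g n V (Z x) = 0.
Proof.
move=> nE g0 xV Z0 Zd ZP; have z0 := Z0 _ xV.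
rewrite /cofactor_sum (sum_subsetsD1 _ xV) big1 // => J JV.
have xJ : x \notin J by move: JV; rewrite subsetD1 => /andP[].
have JU : J \subset V by apply: subset_trans JV (subD1set _ _).
have th0 : th (Z x / Z x) = 0 by rewrite divff // (th_one thP).
have -> : num_out n #|J| V J (Z x) = 0.
  by rewrite /num_out (@prod_eq0 (V :\: J) (fun r => th (Z x / Z r)) x) ?inE ?xV ?xJ //
      !(mul0r, mulr0).
have -> : num_in g n #|x |: J| V (x |: J) (Z x) = 0.
  by rewrite /num_in (@prod_eq0 (x |: J) (fun r => th (Z x / Z r)) x) ?setU11 // !(mul0r,
      mulr0).
rewrite !mulr0 add0r addr0 cardsU1 xJ add1n; set k := #|J|; set z := Z x in z0 *.
have kn : (k.+1 < n)%N.
  have := subset_leq_card JV; have := cardsD1 x V; rewrite xV -/k -nE /= => -> ; lia.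
have dz i : i \in V :\ x -> [/\ Z i != 0, th (z / Z i) != 0 & th (Z i / z) != 0].
  by case/setD1P => ix iV; split; [exact: Z0 | apply: Zd; rewrite // eq_sym | exact: Zd].
rewrite (part_term_in _ _ _ _ xV JV) (part_term_out _ _ _ _ xV JV) -/z.
set pt := part_term _ _ _ _ _ _.
have p1 : th (z * q ^+ k.+1) != 0 := ZP _ xV _ kn.
have p0 : th (z * q ^+ k) != 0 := ZP _ xV _ (ltnW kn).
have o1 := qf_other_poles z kn; have o0 := qf_other_poles z (ltnW kn).
have {}o1 : other_poles n k.+1 z = qf z n / th (z * q ^+ k.+1).
  by rewrite o1 mulrAC divff ?mul1r.
have {}o0 : other_poles n k z = qf z n / th (z * q ^+ k).
  by rewrite o0 mulrAC divff ?mul1r.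
rewrite /num_out /num_in {}o1 {}o0 setDU1 (setD1U xV JV).
rewrite !big_setU1 /= ?inE ?eqxx ?andbF // -/z.
have cU : #|x |: (V :\ x) :\: J| = #|(V :\ x) :\: J|.+1.
  by rewrite cardsU1 !inE eqxx andbF.
rewrite {}cU.
have -> : z / (z / q) = q by rewrite invf_div mulrC divfK.
have -> : th (z / (q * z)) = - (q^-1 * th q).
  by rewrite -(th_inv thP) // invfM mulrCA divff // mulr1.
set A := \prod_(s in J) th (z / (Z s / q)).
set B := \prod_(r in (V :\ x) :\: J) th (z / (q * Z r)).
have eB : \prod_(r in (V :\ x) :\: J) (th (q * Z r / z) / th (Z r / z)) *
    \prod_(r in (V :\ x) :\: J) th (z / Z r) = q ^+ #|(V :\ x) :\: J| * B.
  rewrite -prodr_const -!big_split /=; apply: eq_bigr => r /setDP[/dz[zr d1 d2] _].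
  rewrite -(mulrA q) (th_swap z0 (mulf_neq0 q0 zr)) (th_swap z0 zr).
  by rewrite mulrA; field; rewrite zr q0.
have eA : \prod_(s in J) (th (q * z / Z s) / th (z / Z s)) *
    \prod_(s in J) th (z / Z s) = A.
  rewrite -!big_split /=; apply: eq_bigr => s /(subsetP JV) /dz[zs d1 d2].
  rewrite divfK //; congr th; by field; rewrite zs q0.
rewrite /in_weight /out_weight.
transitivity (pt * th (z * d) * th (z / g) * th (z / b) * th (z / c) * qf z n / th (z * q
    ^+ k.+1) *
  (th q * A / th (z * q ^+ k.+1 / q) *
   (\prod_(r in (V :\ x) :\: J) (th (q * Z r / z) / th (Z r / z)) *
    \prod_(r in (V :\ x) :\: J) th (z / Z r)) -
   th q / th (z * q ^+ k) *
   (\prod_(s in J) (th (q * z / Z s) / th (z / Z s)) * \prod_(s in J) th (z / Z s)) *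
   (q ^+ #|(V :\ x) :\: J| * B))); last first.
  by rewrite eB eA exprSr mulrA mulfK //; ring.
have -> : z * q ^+ k.+1 / q = z * q ^+ k by rewrite exprSr mulrA mulfK.
by rewrite [q ^+ #|_|.+1]exprS; field; rewrite p0 p1.
Qed.

(** For [z = g] the subsets containing the distinguished variable drop out, and
    what remains is the sum for [V] with the parameters [f * q] and [g * q]. *)
Lemma node_param f g n (V : {set T}) : #|V|.+1 = n -> g != 0 ->
  {in V, forall i, Z i != 0} ->
  cofactor_sum f g n V g =
  th f * th (g / b) * th (g / c) * \prod_(s in V) th (g / Z s) * qf g n *
  \sum_(I : {set T} | I \subset V) subset_term (f * q) (g * q) V I.
Proof.
move=> nE g0 Z0; rewrite mulr_sumr; apply: eq_bigr => I IV.
have -> : num_in g n #|I| V I g = 0.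
  by rewrite /num_in divff // (th_one thP) !(mul0r, mulr0).
rewrite mulr0 addr0 /subset_term; set k := #|I|.
have kn : (k < n)%N by rewrite -nE ltnS subset_leq_card.
rewrite (qf_other_poles g kn) (prod_setD _ IV) /num_out /part_term.
have e : \prod_(i in I) in_weight g k (Z i) * \prod_(s in I) th (g / (Z s / q)) =
   q ^+ k * (\prod_(i in I) in_weight (g * q) k (Z i) * \prod_(s in I) th (g / Z s)).
  rewrite -prodr_const -!big_split /=; apply: eq_bigr => i iI.
  have zi := Z0 _ (subsetP IV _ iI); rewrite /in_weight.
  rewrite (th_swap zi g0) (th_swap zi (mulf_neq0 g0 q0)).
  have -> : g / (Z i / q) = g * q / Z i by field; rewrite ?zi ?q0.
  set D := (th (Z i * q ^+ k / q))^-1.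
  by field; rewrite ?zi ?g0 ?q0.
have ec : subset_coef f g n k * q ^+ k =
    th f * th (g * q ^+ k) * subset_coef (f * q) (g * q) #|V| k.
  rewrite /subset_coef; have -> : (n - k = (#|V| - k).+1)%N by rewrite -nE subSn //
      subset_leq_card.
  rewrite qfS [qf f _]qfS exprMn [g * q ^+ k * q]mulrAC; ring.
transitivity (subset_coef f g n k * (th (g / b) * th (g / c) *
   (\prod_(i in I) in_weight g k (Z i) * \prod_(s in I) th (g / (Z s / q)))) *
   (\prod_(i in V :\: I) out_weight k (Z i) * \prod_(r in V :\: I) th (g / Z r) *
       cross_weight V I * other_poles n k g)).
  by ring.
rewrite e; transitivity (subset_coef f g n k * q ^+ k * (th (g / b) * th (g / c) *
   (\prod_(i in I) in_weight (g * q) k (Z i) * \prod_(s in I) th (g / Z s))) *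
   (\prod_(i in V :\: I) out_weight k (Z i) * \prod_(r in V :\: I) th (g / Z r) *
       cross_weight V I * other_poles n k g)).
  by ring.
by rewrite ec; ring.
Qed.

(** Where the common denominator does not vanish, [cofactor_sum] is the original
    sum times this denominator. *)
Lemma cofactor_sum_Z f g n (U : {set T}) x : x \in U -> #|U| = n ->
  {in U, forall i, Z i != 0} ->
  {in U &, forall i j, i != j -> th (Z i / Z j) != 0} ->
  {in U, forall i k, (k < n)%N -> th (Z i * q ^+ k) != 0} ->
  g != 0 ->
  cofactor_sum f g n (U :\ x) (Z x) =
  \prod_(s in U :\ x) th (Z x / Z s) * qf (Z x) n *
  \sum_(I : {set T} | I \subset U) subset_term f g U I.
Proof.
move=> xU nE Z0 Zd ZP g0; rewrite (sum_subsetsD1 _ xU) mulr_sumr.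
apply: eq_bigr => I IV.
have xI : x \notin I by move: IV; rewrite subsetD1 => /andP[].
rewrite /subset_term cardsU1 xI add1n nE.
rewrite (part_term_in _ _ _ _ xU IV) (part_term_out _ _ _ _ xU IV).
set k := #|I|; set V := U :\ x in IV *; set z := Z x.
have z0 : z != 0 := Z0 _ xU.
have kn : (k < n)%N.
  by rewrite -nE (cardsD1 x) xU add1n ltnS subset_leq_card.
have p0 : th (z * q ^+ k) != 0 := ZP _ xU _ kn.
have dz i : i \in V -> [/\ Z i != 0, th (z / Z i) != 0 & th (Z i / z) != 0].
  by case/setD1P => ix iV; split; [exact: Z0 | apply: Zd; rewrite // eq_sym | exact: Zd].
rewrite (qf_other_poles z kn) (prod_setD _ IV) mulrDr; congr (_ + _).
  rewrite /num_out.
  have -> : \prod_(s in I) th (z / (Z s / q)) = \prod_(s in I) (th (q * z / Z s) / th (z /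
      Z s)) * \prod_(s in I) th (z / Z s).
    rewrite -big_split /=; apply: eq_bigr => s /(subsetP IV) /dz[zs d1 _].
    by rewrite divfK //; congr th; field; rewrite zs q0.
  by rewrite /out_weight; field.
rewrite /num_in.
have -> : q ^+ #|V :\: I| * \prod_(r in V :\: I) th (z / (q * Z r)) =
  \prod_(r in V :\: I) (th (q * Z r / z) / th (Z r / z)) * \prod_(r in V :\: I) th (z / Z r).
  rewrite -prodr_const -!big_split /=; apply: eq_bigr => r /setDP[/dz[zr _ d2] _].
  rewrite (th_swap z0 (mulf_neq0 q0 zr)) (th_swap z0 zr).
  by field; rewrite ?zr ?z0 ?q0 ?d2.
rewrite /in_weight (_ : z * q ^+ k.+1 / q = z * q ^+ k); last by rewrite exprSr mulrA mulfK.
by field.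
Qed.

Lemma separated_nodes g n (V : {set T}) : #|V|.+1 = n -> g != 0 ->
  {in V, forall i, Z i != 0} ->
  {in V &, forall i j, i != j -> th (Z i / Z j) != 0} ->
  {in V, forall i k, (k < n)%N -> th (Z i * q ^+ k) != 0} ->
  {in V, forall i, th (g / Z i) != 0} ->
  (forall k, (k < n)%N -> th (g * q ^+ k) != 0) ->
  (forall k, (0 < k < n)%N -> th (q ^+ k) != 0) ->
  separated (g :: [seq Z i | i <- enum V] ++ [seq q ^- l | l <- iota 0 n]).
Proof.
move=> nE g0 Z0 Zd ZP gZ gP qP; apply: separated_pairwise.
  rewrite inE negb_or eq_sym g0 mem_cat negb_or /=; apply/andP; split.
    by apply/mapP => -[i]; rewrite mem_enum => /Z0/eqP h /esym.
  by apply/mapP => -[l _] /esym/eqP; rewrite invr_eq0 expf_eq0 (negPf q0) andbF.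
have in_enum i : i \in enum V -> i \in V by rewrite mem_enum.
rewrite /= all_cat pairwise_cat; apply/and4P; split.
- rewrite !all_map; apply/andP; split; apply/allP => y /=.
    by move=> /in_enum; apply: gZ.
  by rewrite mem_iota => /andP[_ ln]; rewrite invrK; apply: gP.
- apply/allrelP => y y' /mapP[i /in_enum iV ->] /mapP[l].
  by rewrite mem_iota => /andP[_ ln] ->; rewrite invrK; apply: ZP.
- rewrite pairwise_map; have := enum_uniq V; rewrite uniq_pairwise.
  apply: (sub_in_pairwise (P := mem V)); last by apply/allP => i; rewrite mem_enum.
  by move=> i j /= iV jV; apply: Zd.
- rewrite pairwise_map.
  apply: (sub_in_pairwise (P := fun l => (l < n)%N) (r := ltn)); first last.
  + by rewrite -(sorted_pairwise ltn_trans) iota_ltn_sorted.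
  + by apply/allP => l; rewrite mem_iota.
  move=> l l' _ ln' ll' /=.
  have -> : q ^- l / q ^- l' = q ^+ (l' - l).
    apply: (mulIf (expf_neq0 l q0)); rewrite -exprD subnK 1?ltnW //.
    by rewrite invrK mulrAC mulVf ?mul1r // expf_neq0.
  apply: qP; rewrite subn_gt0; apply/andP; split=> //; exact: (leq_ltn_trans (leq_subr _ _)
      ln').
Qed.

Lemma theta_span_cofactor_sum f g n (V : {set T}) ka : #|V|.+1 = n ->
  g != 0 -> f != 0 -> g = f * b * c -> d * q = f * q ^+ n ->
  {in V, forall i, Z i != 0} ->
  exists2 D, theta_span (n + n) (b * c * (\prod_(i in V) Z i * \prod_(l < n) q ^- l)) D
    & forall z, D z = cofactor_sum f g n V z -
        ka * (th (z / (b * c)) * \prod_(s in V) th (z / Z s) * qf z n).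
Proof.
move=> nE g0 f0 gE dE Z0; set nu := (b * c * _).
have sca k d' m h : theta_mon d' m h -> theta_mon d' m (fun z => k * h z).
  by move=> hm; apply: (eq_theta_mon (theta_monM (theta_mon_const k) hm)); rewrite ?mul1r.
have [|D sD eD] := @theta_span_sum (n + n) nu {set T} (fun I => I \subset V)
  (fun I z => part_term f g n #|I| V I * num_out n #|I| V I z +
     part_term f g n #|I|.+1 V I * num_in g n #|I| V I z).
  move=> I IV; apply: theta_spanD; apply: theta_span_mon; apply: sca.
    exact: num_out_mon.
  exact: (num_in_mon (f := f)).
exists (fun z => D z + - ka * (th (z / (b * c)) * \prod_(s in V) th (z / Z s) * qf z n)).
  apply: theta_spanD => //; apply: theta_span_mon; apply: sca.
  exact: num_rhs_mon.
by move=> z; rewrite eD mulNr.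
Qed.

(** The variable [x] is chosen such that no other variable differs from [g] by a
    zero of theta: [g] can then serve as a node along with the others.  If
    some variable does, that one has to be [x]. *)
Theorem subset_sum (U : {set T}) f g : subset_generic g U ->
  f != 0 -> g = f * b * c -> d * q = f * q ^+ #|U| ->
  \sum_(I : {set T} | I \subset U) subset_term f g U I = subset_rhs g U.
Proof.
have [m] := ubnP #|U|; elim: m U f g => // m IH U f g Um gen f0 gE dE.
have [tf|tf] := eqVneq (th f) 0; first exact: subset_sum_degenerate.
have [Z0 Zd ZP gP qP] := gen.
have g0 : g != 0 by rewrite gE !mulf_neq0.
have [U0|/set0Pn[y yU]] := eqVneq U set0.
  rewrite {}U0 in gen dE *; rewrite (big_pred1 set0); last by move=> I; rewrite subset0.
  rewrite /subset_term /part_term /subset_coef /cross_weight /subset_rhs set0D !big_set0.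
  by rewrite cards0 !qf0 expr0 !mulr1.
have {y yU} [x xU gx] : exists2 x, x \in U & {in U :\ x, forall s, th (g / Z s) != 0}.
  have [/exists_inP[x xU /eqP tx]|/exists_inPn nx] := boolP [exists (x | x \in U), th (Z x
      / g) == 0].
    exists x => // s /setD1P[sx sU]; rewrite th_divC_eq0 ?Z0 //.
    apply/negP => /eqP ts; have := Zd _ _ sU xU sx.
    rewrite (_ : Z s / Z x = (Z s / g) / (Z x / g)); last by field; rewrite g0 Z0.
    by rewrite th_div_eq0 ?eqxx // mulf_neq0 ?invr_eq0 // Z0.
  exists y => // s /setD1P[_ sU]; rewrite th_divC_eq0 ?Z0 //; exact: nx.
set n := #|U| in dE ZP gP qP *; set V := U :\ x in gx *.
have nE : #|V|.+1 = n by rewrite /n (cardsD1 x U) xU.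
have VU i : i \in V -> i \in U by case/setD1P.
have VZ0 : {in V, forall i, Z i != 0} by move=> i /VU; apply: Z0.
have VZd : {in V &, forall i j, i != j -> th (Z i / Z j) != 0}.
  by move=> i j /VU iU /VU; apply: Zd.
have VZP : {in V, forall i k, (k < n)%N -> th (Z i * q ^+ k) != 0}.
  by move=> i /VU; apply: ZP.
have IHV : \sum_(I : {set T} | I \subset V) subset_term (f * q) (g * q) V I = subset_rhs (g
    * q) V.
  apply: IH.
  - by rewrite -ltnS nE.
  - split=> //.
    + by move=> i iV k kn; apply: VZP => //; rewrite -nE ltnW.
    + by move=> k kn; rewrite -mulrA -exprS; apply: gP; rewrite -nE.
    + by move=> k /andP[k0 kn]; apply: qP; rewrite k0 -nE ltnW.
  - by rewrite mulf_neq0.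
  - by rewrite gE; ring.
  - by rewrite dE -nE exprS mulrA.
pose ka := qf (g / b) n * qf (g / c) n * \prod_(i in V) th (Z i / (b * c)).
have [D sD eD] := theta_span_cofactor_sum ka nE g0 f0 gE dE VZ0.
have sep := separated_nodes nE g0 VZ0 VZd VZP gx gP qP.
have D0 : {in g :: [seq Z i | i <- enum V] ++ [seq q ^- l | l <- iota 0 n], forall a, D a = 0}.
  move=> a; rewrite inE mem_cat => /predU1P[->|/orP[/mapP[i iV ->]|/mapP[l ln ->]]]; rewrite eD.
  - rewrite node_param // IHV /subset_rhs /ka -nE !qfS.
    have -> : g / (b * c) = f by rewrite gE; field; rewrite b0 c0.
    rewrite ![g * q / _]mulrAC; ring.
  - rewrite mem_enum in iV; rewrite node_variable //.
    rewrite (@prod_eq0 V (fun s => th (Z i / Z s)) i) //; last by rewrite divff ?VZ0 //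
        (th_one thP).
    by rewrite !(mul0r, mulr0) subr0.
  move: ln; rewrite mem_iota => /andP[_ ln].
  rewrite /cofactor_sum big1; last by move=> I IV; exact: node_pole.
  by rewrite (qf_other_poles _ ln) mulVf ?expf_neq0 // (th_one thP) !(mul0r, mulr0) subr0.
have Zx0 := Z0 _ xU.
have : D (Z x) = 0.
  apply: (theta_span_interp sD sep) => //.
  - by rewrite /= size_cat !size_map size_iota -cardE -nE addSn.
  - rewrite !mulf_neq0 //; apply/prodf_neq0 => // l _.
    by rewrite invr_eq0 expf_neq0.
  rewrite big_cons big_cat /= !big_map big_enum /=.
  have -> : \prod_(l <- iota 0 n) q ^- l = \prod_(l < n) q ^- l.
    by rewrite -[RHS](big_mkord xpredT (fun l => q ^- l)) /index_iota subn0.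
  set A := \prod_(i in V) Z i; set B := \prod_(l < n) q ^- l.
  have A0 : A != 0 by apply/prodf_neq0.
  have B0 : B != 0 by apply/prodf_neq0 => l _; rewrite invr_eq0 expf_neq0.
  (* The product condition of the interpolation is that f is not a zero. *)
  have -> : b * c * (A * B) / (g * (A * B)) = f^-1.
    by rewrite gE; field; rewrite f0 b0 c0 A0 B0.
  by rewrite (th_inv thP) // oppr_eq0 mulf_neq0 ?invr_eq0.
rewrite eD (cofactor_sum_Z (g := g) f xU) // => /eqP; rewrite subr_eq0 => /eqP e.
have P0 : \prod_(s in V) th (Z x / Z s) * qf (Z x) n != 0.
  rewrite mulf_neq0 ?qf_neq0 //; last by move=> k; apply: ZP.
  by apply/prodf_neq0 => s /setD1P[sx sU]; apply: Zd; rewrite // eq_sym.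
apply: (mulfI P0); rewrite {}e /subset_rhs -/n (big_setD1 x xU) /= -/V /ka; ring.
Qed.
End SubsetSum.

(** * The Jackson summation over a box *)

Section BoxSum.
Variables (q : F) (q0 : q != 0) (n : nat) (b c d : F).
Hypotheses (b0 : b != 0) (c0 : c != 0) (d0 : d != 0).
Variables (z : 'I_n -> F) (j N : 'I_n -> nat).
Hypothesis jN : forall r, (j r <= N r)%N.

Let M r : nat := (N r - j r)%N.
Let T : finType := {r : 'I_n & 'I_(M r)}.
Let zeta (t : T) : F := z (tag t) * q ^+ (tagged t : nat).

(** The term of [subset_sum] for the variables [zeta] and the union of the initial
    segments of lengths [m], after the products along strings are telescoped. *)
Definition box_term (f g : F) (m : 'I_n -> nat) : F :=
  subset_coef q b c f g (\sum_r M r) (\sum_r m r) *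
  \prod_r (qf q (z r * d) (m r) * qf q (z r / g) (m r) /
           qf q (z r * q ^+ (\sum_s m s) / q) (m r)) *
  \prod_r (qf q (z r * q ^+ m r / b) (M r - m r) *
           qf q (z r * q ^+ m r / c) (M r - m r) /
           qf q (z r * q ^+ m r * q ^+ (\sum_s m s)) (M r - m r)) *
  \prod_r \prod_s (qf q (q ^+ (m r).+1 * z r / z s) (M r - m r) /
           qf q (q ^ (1 + (m r)%:Z - (m s)%:Z) * z r / z s) (M r - m r)).

Definition initial_set (m : 'I_n -> nat) : {set T} :=
  [set t : T | (tagged t < m (tag t))%N].

Lemma prod_string (P : 'I_n -> nat -> bool) (G : 'I_n -> nat -> F) :
  \prod_(t : T | P (tag t) (tagged t)) G (tag t) (tagged t) =
  \prod_r \prod_(i < M r | P r i) G r i.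
Proof.
by rewrite (sig_big_dep xpredT (fun r (i : 'I_(M r)) => P r i) (fun r (i : 'I_(M r)) => G r i)).
Qed.

Lemma prod_initial (m : 'I_n -> nat) (G : 'I_n -> nat -> F) : (forall r, (m r <= M r)%N) ->
  \prod_(t in initial_set m) G (tag t) (tagged t) = \prod_r \prod_(i < m r) G r i.
Proof.
move=> mM; rewrite (eq_bigl (fun t : T => tagged t < m (tag t))%N); last by move=> t;
    rewrite inE.
rewrite (prod_string (fun r i => i < m r)%N); apply: eq_bigr => r _.
by rewrite (big_ord_widen (M r) (G r)).
Qed.

Lemma prod_initialC (m : 'I_n -> nat) (G : 'I_n -> nat -> F) : (forall r, (m r <= M r)%N) ->
  \prod_(t in setT :\: initial_set m) G (tag t) (tagged t) =
  \prod_r \prod_(i < M r - m r) G r (m r + i)%N.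
Proof.
move=> mM; rewrite (eq_bigl (fun t : T => m (tag t) <= tagged t)%N); last first.
  by move=> t; rewrite in_setD in_setT andbT inE -leqNgt.
rewrite (prod_string (fun r i => m r <= i)%N); apply: eq_bigr => r _.
rewrite -(big_geq_mkord _ _ xpredT) -{1}[m r]add0n big_addn big_mkord.
by apply: eq_bigr => i _; rewrite addnC.
Qed.

Definition string_generic (g : F) : Prop :=
  [/\ forall r, z r != 0,
      forall r s (e : int), r != s -> th (q ^ e * z r / z s) != 0,
      forall r k, th (z r * q ^+ k) != 0,
      forall k, th (g * q ^+ k) != 0 &
      forall k, (0 < k)%N -> th (q ^+ k) != 0].

Lemma th_string_neq0 g r s (i i' : nat) : string_generic g -> (r != s) || (i != i') ->
  th (q ^ (i%:Z - i'%:Z) * z r / z s) != 0.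
Proof.
case=> Z0 Zd _ _ qP; have [<-|rs _] := eqVneq r s; last exact: Zd.
rewrite mulfK // => /= ii'; have [ltii|leii] := ltnP i' i.
  by rewrite subzn 1?ltnW // qP // subn_gt0.
have lt : (i < i')%N by rewrite ltn_neqAle ii' leii.
rewrite -opprB subzn // -invr_expz (th_inv thP) ?expf_neq0 // oppr_eq0.
by rewrite mulf_neq0 ?invr_eq0 ?expf_neq0 // qP // subn_gt0.
Qed.

Lemma string_subset_generic g : string_generic g -> subset_generic q zeta g setT.
Proof.
move=> gen; have [Z0 Zd ZP gP qP] := gen; split.
- by move=> t _; rewrite mulf_neq0 ?expf_neq0.
- move=> t t' _ _ tt'; rewrite /zeta.
  have := @th_string_neq0 g (tag t) (tag t') (tagged t) (tagged t') gen.
  have -> : z (tag t) * q ^+ tagged t / (z (tag t') * q ^+ tagged t') =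
    q ^ ((tagged t)%:Z - (tagged t')%:Z) * z (tag t) / z (tag t').
    by rewrite expfzDr // -invr_expz -!exprnP; field; rewrite Z0 expf_neq0.
  apply; rewrite -negb_and; apply: contra tt' => /andP[/eqP].
  case: t t' => [r i] [r' i'] /= rr'; case: _ / rr' i' => i' /eqP/val_inj ->.
  by rewrite eqxx.
- by move=> t _ k _; rewrite /zeta -mulrA -exprD.
- by [].
- by move=> k /andP[k0 _]; apply: qP.
Qed.

(** For fixed [r] and [s], the product along the string of [s] telescopes. *)
Lemma cross_weight_initial g (m : 'I_n -> nat) : (forall r, (m r <= M r)%N) ->
  string_generic g ->
  cross_weight q zeta setT (initial_set m) =
  \prod_r \prod_s (qf q (q ^+ (m r).+1 * z r / z s) (M r - m r) /
           qf q (q ^ (1 + (m r)%:Z - (m s)%:Z) * z r / z s) (M r - m r)).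
Proof.
move=> mM gen; have [Z0 _ _ _ _] := gen.
pose a r s (i i' : nat) := th (q ^ (1 + i%:Z - i'%:Z) * z r / z s).
rewrite /cross_weight.
transitivity (\prod_(t in setT :\: initial_set m) \prod_s \prod_(i' < m s)
    (a (tag t) s (tagged t) i' / a (tag t) s (tagged t) i'.+1)).
  apply: eq_bigr => t _; rewrite -(prod_initial (fun s i' => a (tag t) s (tagged t) i' / a
      (tag t) s (tagged t) i'.+1)) //.
  apply: eq_bigr => t' _; rewrite /a /zeta; congr (th _ / th _).
    by rewrite -addrA expfzDr // expr1z expfzDr // -invr_expz -!exprnP; field; rewrite Z0
        expf_neq0.
  have -> : 1 + (tagged t)%:Z - (tagged t').+1%:Z = (tagged t)%:Z - (tagged t')%:Z by lia.
  by rewrite expfzDr // -invr_expz -!exprnP; field; rewrite Z0 expf_neq0.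
rewrite (prod_initialC (fun r i => \prod_s \prod_(i' < m s) (a r s i i' / a r s i i'.+1))) //.
apply: eq_bigr => r _; rewrite exchange_big; apply: eq_bigr => s _ /=.
rewrite /qf -prodf_div; apply: eq_bigr => i _.
have tele l : (l <= m s)%N -> \prod_(i' < l) (a r s (m r + i)%N i' / a r s (m r + i)%N i'.+1) =
   a r s (m r + i)%N 0%N / a r s (m r + i)%N l.
  elim: l => [|l IH] lm.
    rewrite big_ord0 divff // /a subr0.
    have -> : 1 + (m r + i)%:Z = (m r + i).+1%:Z - 0%:Z by lia.
    by apply: (th_string_neq0 gen); rewrite orbT.
  rewrite big_ord_recr /= IH 1?ltnW // mulrA divfK // /a.
  have -> : 1 + (m r + i)%:Z - l%:Z = (m r + i).+1%:Z - l%:Z by lia.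
  apply: (th_string_neq0 gen); have [rs|//] := eqVneq r s.
  by move: lm; rewrite -rs; lia.
rewrite tele // /a; congr (th _ / th _).
  have -> : 1 + (m r + i)%:Z - 0%:Z = (m r).+1%:Z + i%:Z by lia.
  by rewrite expfzDr // -?exprnP; ring.
have -> : 1 + (m r + i)%:Z - (m s)%:Z = (1 + (m r)%:Z - (m s)%:Z) + i%:Z by lia.
by rewrite expfzDr // -?exprnP; ring.
Qed.

Lemma card_initial (m : 'I_n -> nat) : (forall r, (m r <= M r)%N) ->
  #|initial_set m| = (\sum_r m r)%N.
Proof.
move=> mM; rewrite -sum1_card (eq_bigl (fun t : T => tagged t < m (tag t))%N); last by
    move=> t; rewrite inE.
rewrite -(sig_big_dep xpredT (fun r (i : 'I_(M r)) => i < m r)%N (fun r (i : 'I_(M r)) =>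
    1%N)) /=.
by apply: eq_bigr => r _; rewrite -(big_ord_widen (M r) (fun=> 1%N)) // sum_nat_const
    card_ord muln1.
Qed.

Lemma card_string : #|[set: T]| = (\sum_r M r)%N.
Proof.
rewrite -(@card_initial M) //; apply: eq_card => -[r i].
by rewrite !inE /= ltn_ord.
Qed.

Lemma subset_term_initial f g (m : 'I_n -> nat) : (forall r, (m r <= M r)%N) ->
  string_generic g ->
  subset_term q zeta b c d f g setT (initial_set m) = box_term f g m.
Proof.
move=> mM gen; rewrite /subset_term /part_term card_initial // card_string.
rewrite (cross_weight_initial mM gen) /box_term; congr (_ * _ * _ * _).
  rewrite (prod_initial (fun r i => in_weight q d g (\sum_s m s) (z r * q ^+ i))) //.
  apply: eq_bigr => r _; rewrite /in_weight -!big_split /= -prodf_div; apply: eq_bigr => i _.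
  by congr (th _ * th _ / th _); ring.
rewrite (prod_initialC (fun r i => out_weight q b c (\sum_s m s) (z r * q ^+ i))) //.
apply: eq_bigr => r _; rewrite /out_weight -!big_split /= -prodf_div; apply: eq_bigr => i _.
by rewrite exprD; congr (th _ * th _ / th _); ring.
Qed.

Definition box_rhs (g : F) : F :=
  qf q (g / b) (\sum_r M r) * qf q (g / c) (\sum_r M r) *
  \prod_r qf q (z r / (b * c)) (M r).

Lemma subset_rhs_string g : subset_rhs q zeta b c g setT = box_rhs g.
Proof.
rewrite /subset_rhs card_string /box_rhs; congr (_ * _).
rewrite (eq_bigl xpredT); last by move=> t; rewrite inE.
rewrite (prod_string (fun _ _ => true) (fun r i => th (z r * q ^+ i / (b * c)))).
apply: eq_bigr => r _; apply: eq_bigr => i _; congr th; ring.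
Qed.

Lemma card_lt_ord m i : (i <= m)%N -> #|[set l : 'I_m | (l < i)%N]| = i.
Proof.
move=> im; rewrite -sum1_card (eq_bigl (fun l : 'I_m => l < i)%N); last by move=> l;
    rewrite inE.
by rewrite -(big_ord_widen m (fun=> 1%N)) // sum_nat_const card_ord muln1.
Qed.

(** A subset of an ordinal closed under predecessors is an initial segment, and
    its length is its size. *)
Lemma in_closed_set m (A : {set 'I_m}) :
  (forall i i' : 'I_m, i' = i.+1 :> nat -> i' \in A -> i \in A) ->
  forall i : 'I_m, (i \in A) = (i < #|A|)%N.
Proof.
move=> step.
have down e : forall i i' : 'I_m, i' = (i + e)%N :> nat -> i' \in A -> i \in A.
  elim: e => [|e IH] i i' ii' iA.
    by move: iA; rewrite addn0 in ii'; rewrite (val_inj ii').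
  have lt : (i.+1 < m)%N by have := ltn_ord i'; lia.
  by apply: (step i (Ordinal lt)) => //; apply: (IH _ i') => //=; rewrite ii' addnS.
move=> i; apply/idP/idP => iA.
  rewrite -[X in (X < _)%N](card_lt_ord (ltnW (ltn_ord i))).
  apply: proper_card; rewrite properE; apply/andP; split.
    by apply/subsetP => l; rewrite inE => li; apply: (down (i - l)%N _ i) => //; lia.
  by apply/subsetPn; exists i; rewrite ?inE ?ltnn.
apply: contraTT iA => iA; rewrite -leqNgt -[X in (_ <= X)%N](card_lt_ord (ltnW (ltn_ord i))).
apply/subset_leq_card/subsetP => l lA; rewrite inE ltnNge; apply: contra iA => il.
by apply: (down (l - i)%N _ l) => //; lia.
Qed.

Definition string_count (I : {set T}) (r : 'I_n) : nat :=
  #|[set i : 'I_(M r) | Tagged (fun r => 'I_(M r)) i \in I]|.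

Lemma string_count_initial m r : (m r <= M r)%N -> string_count (initial_set m) r = m r.
Proof.
move=> mM; rewrite /string_count -[RHS](card_lt_ord mM).
by apply: eq_card => i; rewrite !inE.
Qed.

(** If [I] contains an index of a string but not the preceding one, the cross
    factor of these two variables has the numerator [th 1]. *)
Lemma subset_term_not_initial f g I : string_generic g ->
  I != initial_set (string_count I) -> subset_term q zeta b c d f g setT I = 0.
Proof.
case=> Z0 _ _ _ _; apply: contraNeq => nz; apply/eqP/setP => -[r i].
rewrite inE /= -in_closed_set ?inE // => {}i i' ii'; rewrite !inE => iI.
apply: contraNT nz => niI; rewrite /subset_term /part_term /cross_weight.
set t : T := Tagged (fun r => 'I_(M r)) i in niI.
set t' : T := Tagged (fun r => 'I_(M r)) i' in iI.
rewrite mulf_eq0; apply/orP; right; apply/eqP.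
rewrite (bigD1 t) /= ?inE ?niI // (bigD1 t') //=.
have -> : q * zeta t / zeta t' = 1.
  by rewrite /zeta /= ii' exprS; field; rewrite Z0 q0 expf_neq0.
by rewrite (th_one thP) !mul0r.
Qed.

Lemma eq_initial_set m m' : m =1 m' -> initial_set m = initial_set m'.
Proof. by move=> e; apply/setP => t; rewrite !inE e. Qed.

(** The unions of initial segments correspond to the [k] with [j <= k <= N]. *)
Theorem box_sum_formula f g : string_generic g ->
  f != 0 -> g = f * b * c -> d * q = f * q ^+ (\sum_r M r) ->
  \sum_(k : {dffun forall r : 'I_n, 'I_(N r).+1} | [forall r, j r <= k r]%N)
    box_term f g (fun r => k r - j r)%N = box_rhs g.
Proof.
move=> gen f0 gE dE; rewrite -subset_rhs_string.
rewrite -(subset_sum q0 b0 c0 d0 (string_subset_generic gen) f0 gE) ?card_string //.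
rewrite [RHS](bigID (fun I => I == initial_set (string_count I))) /=.
rewrite [X in _ = _ + X]big1 ?addr0; last first.
  by move=> I /andP[_ /(subset_term_not_initial f gen)].
have cM (I : {set T}) r : (j r + string_count I r < (N r).+1)%N.
  have : (string_count I r <= M r)%N by rewrite -[M r]card_ord max_card.
  by rewrite /M; have := jN r; lia.
have kM (k : {dffun forall r : 'I_n, 'I_(N r).+1}) r : (k r - j r <= M r)%N.
  by rewrite /M leq_sub2r // -ltnS ltn_ord.
rewrite [RHS](reindex_onto
    (fun k : {dffun forall r : 'I_n, 'I_(N r).+1} => initial_set (fun r => k r - j r)%N)
    (fun I => [ffun r => inord (j r + string_count I r)])) /=; last first.
  move=> I /andP[_ /eqP eI]; rewrite [RHS]eI; apply: eq_initial_set => r.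
  by rewrite ffunE inordK // addKn.
symmetry; apply: eq_big => [k|k _]; last by rewrite subset_term_initial.
rewrite subsetT /=; have -> : initial_set (fun r => k r - j r)%N ==
    initial_set (string_count (initial_set (fun r => k r - j r)%N)).
  by apply/eqP/eq_initial_set => r; rewrite string_count_initial.
rewrite /=.
apply/eqP/forallP => [kE r|jk].
  have := congr1 (fun h : {dffun forall r : 'I_n, 'I_(N r).+1} => h r : nat) kE.
  by rewrite ffunE inordK // => <-; rewrite leq_addr.
apply/ffunP => r; rewrite ffunE; apply: val_inj; rewrite /= inordK //.
by rewrite string_count_initial // subnKC.
Qed.

End BoxSum.
End ThetaLike.

(** * The finite triple product *)

Section SymmetricSums.
Variable V : comNzRingType.
Implicit Types f h : int -> V.

(** The sum of [f k] over the integers [k] with [`|k| <= m].  With terms that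
    vanish outside a finite set, such sums stand for sums over all integers. *)
Definition zsum (m : nat) f : V := \sum_(i < m.*2.+1) f (i%:Z - m%:Z).

Lemma zsum0 f : zsum 0 f = f 0.
Proof. by rewrite /zsum big_ord1 subrr. Qed.

Lemma zsumS m f : zsum m.+1 f = f (- m.+1%:Z) + zsum m f + f m.+1%:Z.
Proof.
rewrite /zsum doubleS big_ord_recr big_ord_recl /=; congr (_ + _ + _).
- by rewrite sub0r.
- by apply: eq_bigr => i _; congr f; rewrite /bump; lia.
by congr f; lia.
Qed.

Lemma eq_in_zsum m f h : (forall k, (`|k| <= m)%N -> f k = h k) -> zsum m f = zsum m h.
Proof. by move=> e; apply: eq_bigr => i _; apply: e; have := ltn_ord i; lia. Qed.

Lemma zsumD m f h : zsum m (fun k => f k + h k) = zsum m f + zsum m h.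
Proof. exact: big_split. Qed.

Lemma zsumN m f : zsum m (fun k => - f k) = - zsum m f.
Proof. exact: sumrN. Qed.

Lemma zsum_exchange m m' (f : int -> int -> V) :
  zsum m (fun k => zsum m' (f k)) = zsum m' (fun l => zsum m (fun k => f k l)).
Proof. exact: exchange_big. Qed.

Lemma zsum_opp m f : zsum m (fun k => f (- k)) = zsum m f.
Proof.
elim: m => [|m IH]; first by rewrite !zsum0 oppr0.
by rewrite !zsumS IH opprK addrC [f _ + _]addrC addrA.
Qed.

Lemma zsum_widen m m' f : (m <= m')%N ->
  (forall k, (m < `|k|)%N -> f k = 0) -> zsum m' f = zsum m f.
Proof.
move=> /subnKC <- f0; elim: (m' - m)%N => [|e IH]; first by rewrite addn0.
by rewrite addnS zsumS IH !f0 ?addr0 ?add0r //; lia.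
Qed.

Lemma zsum_shift1 m f : zsum m (fun k => f (k + 1)) = zsum m f - f (- m%:Z) + f m.+1%:Z.
Proof.
elim: m => [|m IH]; first by rewrite !zsum0 add0r oppr0 subrr add0r.
rewrite !zsumS IH (_ : - m.+1%:Z + 1 = - m%:Z); last lia.
rewrite (_ : m.+1%:Z + 1 = m.+2%:Z); last lia.
ring.
Qed.

Lemma zsum_shift m M (s : int) f : (m + `|s| <= M)%N ->
  (forall k, (m < `|k|)%N -> f k = 0) -> zsum M (fun k => f (k + s)) = zsum M f.
Proof.
move=> le; have nat_shift (e : nat) h : (m + e <= M)%N ->
    (forall k, (m < `|k|)%N -> h k = 0) -> zsum M (fun k => h (k + e%:Z)) = zsum M h.
  move=> {f le}le h0; elim: e le => [|e IH] le.
    by apply: eq_in_zsum => k _; rewrite addr0.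
  rewrite -IH; last lia.
  have := zsum_shift1 M (fun k => h (k + e%:Z)).
  rewrite [h (- _ + _)]h0; last lia.
  rewrite [h (M.+1%:Z + _)]h0 ?subr0 ?addr0 => [<-|]; last lia.
  by apply: eq_in_zsum => k _; congr h; lia.
move=> f0; case: s le => e le; first exact: nat_shift.
rewrite -[RHS]zsum_opp -(nat_shift e.+1 (fun k => f (- k))); first last.
- by move=> k mk; apply: f0; rewrite abszN.
- exact: le.
by rewrite -[LHS]zsum_opp; apply: eq_in_zsum => k _; congr f; lia.
Qed.

(** The odd indices [2 * u + 1] with [`|u| <= R] miss the lowest one. *)
Lemma zsum_parity R f : zsum R.*2.+1 f =
  zsum R (fun u => f (u * 2)) + zsum R (fun u => f (u * 2 + 1)) + f (- R.*2.+1%:Z).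
Proof.
elim: R => [|R IH].
  by rewrite zsumS !zsum0 mul0r add0r [RHS]addrC addrA.
rewrite doubleS zsumS zsumS IH !zsumS.
have -> : - R.+1%:Z * 2 = - R.*2.+2%:Z by lia.
have -> : R.+1%:Z * 2 = R.*2.+2%:Z by lia.
have -> : - R.*2.+2%:Z + 1 = - R.*2.+1%:Z by lia.
have -> : R.*2.+2%:Z + 1 = R.*2.+3%:Z by lia.
ring.
Qed.

End SymmetricSums.

Section TripleProduct.
Variables (F : fieldType) (p : F).
Hypothesis p_gen : forall i : nat, 1 - p ^+ i.+1 != 0.

Definition fpoch (a : F) (m : nat) : F := \prod_(l < m) (1 - a * p ^+ l).

Lemma fpochSr a m : fpoch a m.+1 = fpoch a m * (1 - a * p ^+ m).
Proof. by rewrite /fpoch big_ord_recr. Qed.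

Lemma fpochSl a m : fpoch a m.+1 = (1 - a) * fpoch (p * a) m.
Proof.
rewrite /fpoch big_ord_recl expr0 mulr1; congr (_ * _); apply: eq_bigr => i _.
by rewrite exprS mulrCA mulrA.
Qed.

(** [1 / (p; p)_k]; the value 0 for negative [k] is the one for which the
    recurrence of [inv_pochB1] holds also at 0. *)
Definition inv_poch (k : int) : F := if k is Posz i then (fpoch p i)^-1 else 0.

Lemma inv_pochB1 (i : nat) : inv_poch (i%:Z - 1) = (1 - p ^+ i) * inv_poch i.
Proof.
case: i => [|i]; first by rewrite expr0 subrr mul0r.
rewrite (_ : i.+1%:Z - 1 = i); last lia.
rewrite /inv_poch fpochSr -exprS invfM mulrCA mulfV ?mulr1 //.
Qed.

Lemma inv_pochB2 (i : nat) :
  inv_poch (i%:Z - 2) = (1 - p ^+ i.-1) * (1 - p ^+ i) * inv_poch i.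
Proof.
case: i => [|i]; first by rewrite expr0 subrr mulr0 mul0r.
rewrite (_ : i.+1%:Z - 2 = i%:Z - 1); last lia.
rewrite inv_pochB1 -mulrA; congr (_ * _).
by rewrite -inv_pochB1; congr inv_poch; lia.
Qed.

(** The centred Gaussian binomial coefficient of [2 * m] and [m + k]. *)
Definition gauss_bin (m : nat) (k : int) : F :=
  fpoch p m.*2 * inv_poch (m%:Z + k) * inv_poch (m%:Z - k).

Lemma gauss_bin_eq0 m k : (m < `|k|)%N -> gauss_bin m k = 0.
Proof.
move=> mk; rewrite /gauss_bin; case: k mk => k mk.
  have -> : m%:Z - k%:Z = Negz (k - m.+1) by lia.
  by rewrite /= mulr0.
have -> : m%:Z + Negz k = Negz (k - m) by lia.
by rewrite /= mulr0 mul0r.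
Qed.

(** The recurrence that corresponds to the factor
    [(1 - a * p ^+ m) * (1 - p ^+ m.+1 / a)] added to the product. *)
Lemma gauss_bin_pascal m k : (`|k| <= m.+1)%N ->
  gauss_bin m.+1 k = (1 + p ^+ m.*2.+1) * gauss_bin m k +
    p ^+ (absz (m.+1%:Z - k)%R) * gauss_bin m (k - 1) +
    p ^+ (absz (m.+1%:Z + k)%R) * gauss_bin m (k + 1).
Proof.
move=> km; set j := absz (m.+1%:Z - k)%R; set i := absz (m.+1%:Z + k)%R.
have ij : (i + j)%N = m.*2.+2 by lia.
rewrite /gauss_bin.
have -> : m.+1%:Z + k = i by lia.
have -> : m.+1%:Z - k = j by lia.
have -> : m%:Z + k = i%:Z - 1 by lia.
have -> : m%:Z - k = j%:Z - 1 by lia.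
have -> : m%:Z + (k - 1) = i%:Z - 2 by lia.
have -> : m%:Z - (k - 1) = j%:Z by lia.
have -> : m%:Z + (k + 1) = i%:Z by lia.
have -> : m%:Z - (k + 1) = j%:Z - 2 by lia.
rewrite !inv_pochB1 !inv_pochB2 doubleS !fpochSr -!exprS.
set W := p ^+ m.*2.+1; set X := p ^+ i; set Y := p ^+ j.
have -> : p ^+ m.*2.+2 = X * Y by rewrite -exprD ij.
have aux (i' j' : nat) : (i' + j')%N = m.*2.+2 ->
    p ^+ j' * (1 - p ^+ i'.-1) * (1 - p ^+ i') = (p ^+ j' - W) * (1 - p ^+ i').
  case: i' => [|i'] e; first by rewrite expr0 subrr !mulr0.
  by congr (_ * _); rewrite mulrBr mulr1 -exprD; congr (_ - p ^+ _); move: e => /=; lia.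
have EX := aux i j ij; have EY := aux j i (etrans (addnC _ _) ij).
rewrite -/X -/Y in EX EY.
set P := fpoch p m.*2; set vi := inv_poch i; set vj := inv_poch j.
transitivity (P * vi * vj * ((1 + W) * (1 - X) * (1 - Y) + (Y - W) * (1 - X) + (X - W) * (1
    - Y))).
  ring.
by rewrite -EX -EY; ring.
Qed.

(** [k * (k - 1) / 2], the exponent of [p] in the triple product. *)
Definition tri (k : int) : nat := (absz (k * (k - 1))%R %/ 2)%N.

Lemma tri2 k : (tri k)%:Z * 2 = k * (k - 1).
Proof.
have ev e : exists h, e%:Z * (e%:Z - 1) = 2 * h%:Z.
  elim: e => [|e [h eh]]; first by exists 0%N.
  by exists (h + e)%N; lia.
have [h eh] : exists h, k * (k - 1) = 2 * h%:Z.
  case: k => e; first exact: ev.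
  have [h eh] := ev e.+2; exists h; rewrite -eh; lia.
rewrite /tri eh; lia.
Qed.

Definition jacobi_coef (m : nat) (k : int) : F := (-1) ^ k * p ^+ tri k * gauss_bin m k.

Definition fin_theta (m : nat) (a : F) : F :=
  \prod_(l < m) ((1 - a * p ^+ l) * (1 - p ^+ l.+1 / a)).

Lemma fin_thetaE m a : fin_theta m a = fpoch a m * fpoch (p / a) m.
Proof.
rewrite /fin_theta big_split /=; congr (_ * _); apply: eq_bigr => l _.
by rewrite exprS mulrAC.
Qed.

Lemma sgn_int (k : int) : (-1 : F) ^ (k + 1) = - (-1) ^ k.
Proof. by rewrite expfzDr ?oppr_eq0 ?oner_eq0 // expr1z mulrN1. Qed.

Lemma jacobi_coefS m k : (`|k| <= m.+1)%N ->
  jacobi_coef m.+1 k = (1 + p ^+ m.*2.+1) * jacobi_coef m k -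
    p ^+ m * jacobi_coef m (k - 1) - p ^+ m.+1 * jacobi_coef m (k + 1).
Proof.
move=> km; rewrite /jacobi_coef gauss_bin_pascal // sgn_int.
have := sgn_int (k - 1); rewrite subrK => ->.
set s := (-1) ^ (k - 1).
have e1 : p ^+ m * p ^+ tri (k - 1) = p ^+ tri k * p ^+ (absz (m.+1%:Z - k)%R).
  by rewrite -!exprD; congr (_ ^+ _); have := tri2 k; have := tri2 (k - 1); lia.
have e2 : p ^+ m.+1 * p ^+ tri (k + 1) = p ^+ tri k * p ^+ (absz (m.+1%:Z + k)%R).
  by rewrite -!exprD; congr (_ ^+ _); have := tri2 k; have := tri2 (k + 1); lia.
transitivity (- s * ((1 + p ^+ m.*2.+1) * p ^+ tri k * gauss_bin m k +
   (p ^+ tri k * p ^+ (absz (m.+1%:Z - k)%R)) * gauss_bin m (k - 1) +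
   (p ^+ tri k * p ^+ (absz (m.+1%:Z + k)%R)) * gauss_bin m (k + 1))).
  ring.
by rewrite -e1 -e2; ring.
Qed.

Lemma jacobi_coef_eq0 m k : (m < `|k|)%N -> jacobi_coef m k = 0.
Proof. by move=> mk; rewrite /jacobi_coef gauss_bin_eq0 // mulr0. Qed.

Theorem finite_triple_product m a : a != 0 ->
  fin_theta m a = zsum m (fun k => jacobi_coef m k * a ^ k).
Proof.
move=> a0; elim: m => [|m IH].
  have g0 : gauss_bin 0 0 = 1.
    by rewrite /gauss_bin /= /inv_poch /fpoch !big_ord0 invr1 !mulr1.
  by rewrite /fin_theta big_ord0 zsum0 /jacobi_coef g0 !expr0z !mulr1.
have a0k k : a ^ (k + 1) = a ^ k * a by rewrite expfzDr // expr1z.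
rewrite /fin_theta big_ord_recr /= -/(fin_theta m a) {}IH.
set f := fun k => jacobi_coef m k * a ^ k.
have f0 k : (m < `|k|)%N -> f k = 0 by move=> mk; rewrite /f jacobi_coef_eq0 ?mul0r.
have scal (c : F) h M : zsum M (fun k => c * h k) = c * zsum M h by rewrite /zsum mulr_sumr.
have w1 : zsum m f = zsum m.+2 f by apply: esym; apply: zsum_widen => //; lia.
transitivity (zsum m.+2 (fun k => (1 + p ^+ m.*2.+1) * f k - p ^+ m * (a * f (k - 1)) - p
    ^+ m.+1 * (a^-1 * f (k + 1)))).
  rewrite 2!zsumD !zsumN !scal (zsum_shift (m := m) (s := -1)) ?(zsum_shift (m := m) (s :=
      1)) //; try lia.
  rewrite w1 (_ : p ^+ m.*2.+1 = p ^+ m * p ^+ m.+1); last by rewrite -exprD; congr (_ ^+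
      _); lia.
  by rewrite exprS; field.
rewrite (zsum_widen (m := m.+1)) //; last first.
  by move=> k mk; rewrite !f0 ?mulr0 ?subr0 //; lia.
apply: eq_in_zsum => k km; rewrite jacobi_coefS // /f a0k.
have := a0k (k - 1); rewrite subrK => ->.
by field.
Qed.

Definition sq_int (t : int) : nat := absz (t * t)%R.
Definition pronic (t : int) : nat := absz (t * (t + 1))%R.

Lemma tri_even t u : (tri (t + u + 1) + tri (t + 1 - u))%N = (pronic t + sq_int u)%N.
Proof.
have := tri2 (t + u + 1); have := tri2 (t + 1 - u); rewrite /pronic /sq_int.
have pr0 : (0 : int) <= t * (t + 1) by case: t => t; nia.
have sq0 : (0 : int) <= u * u by nia.
nia.
Qed.

Lemma tri_odd t u : (tri (t + u + 1) + tri (t - u))%N = (sq_int t + pronic u)%N.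
Proof.
have := tri2 (t + u + 1); have := tri2 (t - u); rewrite /pronic /sq_int.
have pr0 : (0 : int) <= u * (u + 1) by case: u => u; nia.
have sq0 : (0 : int) <= t * t by nia.
nia.
Qed.

(** The terms [p ^ (d * d / 4) * x ^ d] with [d = t * 2] and with [d = t * 2 + 1];
    in the second case the constant [p ^ (1 / 4)] is left out. *)
Definition even_weight (x : F) (t : int) : F := p ^+ sq_int t * x ^ (t * 2).
Definition odd_weight (x : F) (t : int) : F := p ^+ pronic t * x ^ (t * 2 + 1).

(** The change of variables [k = t + u + 1], [l = t + 1 - u] for [k - l] even and
    [k = t + u + 1], [l = t - u] for [k - l] odd.  It separates [x] from [y] in
    the double series of [theta (x * y) * theta (x / y)]. *)
Lemma zsum_unfold_pair m (H : int -> int -> F) :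
  (forall k l, (m < `|k|)%N || (m < `|l|)%N -> H k l = 0) ->
  zsum m (fun k => zsum m (H k)) =
  zsum m.*2.+1 (fun t => zsum m.*2.+1 (fun u =>
    H (t + u + 1) (t + 1 - u) + H (t + u + 1) (t - u))).
Proof.
move=> H0; set R := m.*2.+1; set M := R.*2.+1.
have split k : zsum m (H k) = zsum R (fun u => H k (k - u * 2)) +
    zsum R (fun u => H k (k - (u * 2 + 1))).
  have [mk|km] := ltnP m `|k|%N.
    rewrite /zsum !big1 ?addr0 // => i _; apply: H0; rewrite mk //.
  set h := fun d => H k (k - d).
  have h0 d : (m.*2 < `|d|)%N -> h d = 0 by move=> md; apply: H0; lia.
  transitivity (zsum M h); last first.
    by rewrite /M zsum_parity h0 ?addr0 // /R; lia.
  rewrite -(zsum_shift (m := m.*2) (s := k) (f := h)) //; last by rewrite /M /R; lia.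
  rewrite -zsum_opp (zsum_widen (m := m)) //.
  - by apply: eq_in_zsum => l _; rewrite /h; congr (H k _); lia.
  - by rewrite /M /R; lia.
  by move=> l ml; apply: H0; lia.
have shift (s : int -> int) u : (m < `|u|)%N \/ (`|u| <= m)%N ->
  (forall k, (m < `|u|)%N -> (m < `|k|)%N || (m < `|s k|)%N) ->
  zsum m (fun k => H k (s k)) = zsum R (fun t => H (t + u + 1) (s (t + u + 1))).
  case=> [mu hs|mu _].
    by rewrite /zsum !big1 // => i _; apply: H0; apply: hs.
  set g := fun k => H k (s k); have g0 k : (m < `|k|)%N -> g k = 0.
    by move=> mk; apply: H0; rewrite mk.
  rewrite -(zsum_widen (m := m) (m' := R)) //; last by rewrite /R; lia.
  rewrite -(zsum_shift (m := m) (s := u + 1) (f := g)) //; last by rewrite /R; lia.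
  by apply: eq_in_zsum => t _; rewrite /g addrA.
transitivity (zsum m (fun k => zsum R (fun u => H k (k - u * 2) + H k (k - (u * 2 + 1))))).
  by apply: eq_in_zsum => k _; rewrite split zsumD.
rewrite zsum_exchange [RHS]zsum_exchange; apply: eq_in_zsum => u _.
have cu : (m < `|u|)%N \/ (`|u| <= m)%N by case: ltnP; [left|right].
rewrite zsumD (shift (fun k => k - u * 2) u) //; last by move=> k; lia.
rewrite (shift (fun k => k - (u * 2 + 1)) u) //; last by move=> k; lia.
by rewrite -zsumD; apply: eq_in_zsum => t _; congr (H _ _ + H _ _); lia.
Qed.

(** Were the coefficients [gauss_bin] constant, the right-hand side would be a
    2x2 determinant of sums in [x] and sums in [y]. *)
Lemma finite_theta_pair m x y : x != 0 -> y != 0 ->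
  fin_theta m (x * y) * fin_theta m (x / y) =
  zsum m.*2.+1 (fun t => zsum m.*2.+1 (fun u =>
    gauss_bin m (t + u + 1) * gauss_bin m (t + 1 - u) *
      (x * odd_weight x t * even_weight y u) -
    gauss_bin m (t + u + 1) * gauss_bin m (t - u) *
      (x * even_weight x t * odd_weight y u))).
Proof.
move=> x0 y0; rewrite !finite_triple_product ?mulf_neq0 ?invr_eq0 //.
pose H k l := jacobi_coef m k * (x * y) ^ k * (jacobi_coef m l * (x / y) ^ l).
transitivity (zsum m (fun k => zsum m (H k))).
  by rewrite /zsum mulr_suml; apply: eq_bigr => i _; rewrite mulr_sumr.
rewrite zsum_unfold_pair; last first.
  by move=> k l /orP[] /jacobi_coef_eq0 e; rewrite /H e !(mul0r, mulr0).
apply: eq_in_zsum => t _; apply: eq_in_zsum => u _.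
have EH k l : H k l = (-1) ^ (k + l) * (gauss_bin m k * gauss_bin m l) *
    (p ^+ (tri k + tri l) * (x ^ (k + l) * y ^ (k - l))).
  rewrite /H /jacobi_coef !expfzMl exprD !expfzDr ?oppr_eq0 ?oner_eq0 //.
  by rewrite exprz_inv; ring.
have sg2 v : (-1 : F) ^ (v * 2) = 1 by rewrite mulrC -exprz_exp -exprnP sqrrN expr1n exp1rz.
rewrite !EH tri_even tri_odd.
have -> : t + u + 1 + (t + 1 - u) = (t + 1) * 2 by lia.
have -> : t + u + 1 - (t + 1 - u) = u * 2 by lia.
have -> : t + u + 1 + (t - u) = t * 2 + 1 by lia.
have -> : t + u + 1 - (t - u) = u * 2 + 1 by lia.
rewrite sg2 sgn_int sg2 mul1r /odd_weight /even_weight.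
have -> : (t + 1) * 2 = t * 2 + 1 + 1 by lia.
rewrite ![x ^ (_ + 1)]expfzDr // expr1z !exprD; ring.
Qed.

End TripleProduct.

(** * Limits of complex sequences *)

Require Import Defs.
From mathcomp Require Import complex lra.
From mathcomp Require Import all_classical all_reals all_analysis.

Import Order.TTheory GRing.Theory Num.Theory.
Import numFieldNormedType.Exports.
Local Open Scope ring_scope.
Local Open Scope complex_scope.

Section ComplexLimits.
Local Open Scope classical_set_scope.
Local Open Scope ring_scope.

(** The next three lemmas are stated for an abstract field, where the unification
    with the topology of [R[i]^o] is cheap. *)
Lemma regular_cvgM (K : numFieldType) (u v : nat -> K^o) (l l' : K^o) :
  u @ \oo --> l -> v @ \oo --> l' -> (fun m => u m * v m : K^o) @ \oo --> (l * l' : K^o).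
Proof. exact: cvgM. Qed.

Lemma regular_cvgD (K : numFieldType) (u v : nat -> K^o) (l l' : K^o) :
  u @ \oo --> l -> v @ \oo --> l' -> (fun m => u m + v m) @ \oo --> l + l'.
Proof. exact: cvgD. Qed.

Lemma regular_cvgV (K : numFieldType) (u : nat -> K^o) (l : K^o) :
  l != 0 -> u @ \oo --> l -> (fun m => (u m)^-1 : K^o) @ \oo --> (l^-1 : K^o).
Proof. by move=> l0; apply: cvgV. Qed.

Variable R : realType.
Implicit Types (u v : nat -> R[i]) (z w l : R[i]).

Definition cmod z : R := Normc.normc z.

Lemma cmodE z : `|z| = (cmod z)%:C. Proof. by []. Qed.

Lemma cmod_ge0 z : 0 <= cmod z. Proof. by rewrite -ler0c -cmodE. Qed.

Lemma cmod0 : cmod 0 = 0. Proof. exact: Normc.normc0. Qed.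

Lemma cmod1 : cmod 1 = 1. Proof. exact: Normc.normc1. Qed.

Lemma cmodM z w : cmod (z * w) = cmod z * cmod w. Proof. exact: Normc.normcM. Qed.

Lemma cmodV z : cmod z^-1 = (cmod z)^-1. Proof. exact: Normc.normcV. Qed.

Lemma cmodD z w : cmod (z + w) <= cmod z + cmod w.
Proof. by rewrite -lecR rmorphD /= -!cmodE ler_normD. Qed.

Lemma cmodN z : cmod (- z) = cmod z.
Proof. by apply/complexI; rewrite -!cmodE normrN. Qed.

Lemma cmodX z k : cmod (z ^+ k) = cmod z ^+ k.
Proof. by elim: k => [|k IH]; rewrite ?cmod1 // !exprS cmodM IH. Qed.

Lemma cmod_eq0 z : (cmod z == 0) = (z == 0).
Proof. by apply/eqP/eqP => [/Normc.eq0_normc -> //|->]; rewrite ?cmod0. Qed.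

Lemma cmod_sum (I : Type) (r : seq I) (P : pred I) (f : I -> R[i]) :
  cmod (\sum_(i <- r | P i) f i) <= \sum_(i <- r | P i) cmod (f i).
Proof.
elim/big_rec2: _ => [|i y z _ h]; first by rewrite cmod0.
by apply: le_trans (cmodD _ _) _; rewrite lerD2l.
Qed.

Lemma cmod_ge_Re z : `|complex.Re z| <= cmod z.
Proof. by rewrite -lecR -cmodE normc_ge_Re. Qed.

Lemma cmod_ge_Im z : `|complex.Im z| <= cmod z.
Proof.
have -> : complex.Im z = - complex.Re (z * 'i%C) by rewrite ReiNIm opprK.
rewrite normrN; apply: le_trans (cmod_ge_Re _) _.
rewrite cmodM (_ : cmod 'i%C = 1) ?mulr1 //.
by rewrite /cmod /= expr0n add0r expr1n sqrtr1.
Qed.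

Lemma cmod_le_ReIm z : cmod z <= `|complex.Re z| + `|complex.Im z|.
Proof.
rewrite {1}[z]complexE; apply: le_trans (cmodD _ _) _; apply: lerD.
  by rewrite /cmod /= expr0n addr0 sqrtr_sqr.
rewrite cmodM (_ : cmod 'i%C = 1); last by rewrite /cmod /= expr0n add0r expr1n sqrtr1.
by rewrite mul1r /cmod /= expr0n addr0 sqrtr_sqr.
Qed.

(** A record: as a definition it would unfold to a product, and the arguments of
    lemmas that conclude to convergence would become implicit. *)
Record tends u l : Prop := Tends {
  tends_cvg : (u : nat -> R[i]^o) @ \oo --> (l : R[i]^o) }.

Lemma tendsP u l : tends u l <->
  forall e : R, 0 < e -> exists N, forall m, (N <= m)%N -> cmod (u m - l) < e.
Proof.
have E m : `|l - u m| = (cmod (u m - l))%:C by rewrite -normrN opprB.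
split.
  move=> [/cvgrPdist_lt h] e e0; have [|N _ hN] := h e%:C; first by rewrite ltcR.
  by exists N => m Nm; have := hN m Nm; rewrite /= E ltcR.
move=> h; split; apply/cvgrPdist_lt => e e0.
have eE : e = (complex.Re e)%:C by rewrite RRe_real // gtr0_real.
have [|N hN] := h (complex.Re e); first by rewrite -ltcR -eE.
by exists N => // m /= Nm; rewrite E eE ltcR; apply: hN.
Qed.

Lemma tends_uniq u l l' : tends u l -> tends u l' -> l = l'.
Proof. by move=> [h] [h']; rewrite -(cvg_lim (@norm_hausdorff _ R[i]^o) h) (cvg_lim
    (@norm_hausdorff _ R[i]^o) h'). Qed.

Lemma tends_lim u l : tends u l -> limn (u : nat -> R[i]^o) = l.
Proof. by move=> [h]; apply: (cvg_lim (@norm_hausdorff _ R[i]^o) h). Qed.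

Lemma tends_cst l : tends (fun=> l) l. Proof. split; exact: cvg_cst. Qed.

Lemma tendsM u v l l' : tends u l -> tends v l' -> tends (fun m => u m * v m) (l * l').
Proof. move=> [hu] [hv]; split; exact: (regular_cvgM hu hv). Qed.

Lemma tendsD u v l l' : tends u l -> tends v l' -> tends (fun m => u m + v m) (l + l').
Proof. move=> [hu] [hv]; split; exact: (regular_cvgD hu hv). Qed.

Lemma tends_ev u v l N : (forall m, (N <= m)%N -> u m = v m) -> tends u l -> tends v l.
Proof.
move=> e /tendsP h; apply/tendsP => eps e0; have [N' hN] := h _ e0.
exists (maxn N N') => m; rewrite geq_max => /andP[Nm N'm].
by rewrite -e // hN.
Qed.

Lemma tendsB u v l l' : tends u l -> tends v l' -> tends (fun m => u m - v m) (l - l').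
Proof. 
move=> hu hv; have := tendsD hu (tendsM (tends_cst (-1)) hv).
rewrite mulN1r; apply: (tends_ev (N := 0)) => m _; rewrite mulN1r //.
 Qed.

Lemma tendsV u l : l != 0 -> tends u l -> tends (fun m => (u m)^-1) l^-1.
Proof. move=> l0 [hu]; split; exact: (regular_cvgV l0 hu). Qed.

Lemma tends_sub u l (s : nat -> nat) : (forall N, exists M, forall m, (M <= m)%N -> (N <= s
    m)%N) ->
  tends u l -> tends (fun m => u (s m)) l.
Proof.
move=> hs /tendsP h; apply/tendsP => e e0; have [N hN] := h _ e0.
by have [M hM] := hs N; exists M => m /hM/hN.
Qed.

Lemma tends_bounded u l : tends u l -> exists B : R, forall m, cmod (u m) <= B.
Proof.
move=> /tendsP /(_ 1 ltr01) [N hN].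
exists (\sum_(m < N) cmod (u m) + (cmod l + 1)) => m.
have S0 : 0 <= \sum_(m < N) cmod (u m) by apply: sumr_ge0 => i _; apply: cmod_ge0.
have [Nm|mN] := leqP N m.
  have := hN m Nm; have := cmodD (u m - l) l; rewrite subrK; lra.
rewrite (bigD1 (Ordinal mN)) //=.
have : 0 <= \sum_(i < N | i != Ordinal mN) cmod (u i) by apply: sumr_ge0 => i _; apply:
    cmod_ge0.
by have := cmod_ge0 l; lra.
Qed.

Lemma tends_geometric u (K r : R) : 0 <= r < 1 ->
  (forall m, cmod (u m.+1 - u m) <= K * r ^+ m) -> exists l, tends u l.
Proof.
move=> /andP[r0 r1] hu.
have real_cvg (a : nat -> R) : (forall m, `|a m.+1 - a m| <= K * r ^+ m) -> exists l : R, a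
    @ \oo --> l.
  move=> ha; have K0 : 0 <= K by have := ha 0%N; rewrite expr0 mulr1; apply: le_trans.
  have : cvgn (series (telescope a)).
    apply: normed_cvg; apply: (series_le_cvg (v_ := geometric K r)) => //.
    - by move=> m; apply: normr_ge0.
    - by move=> m; apply: mulr_ge0 => //; apply: exprn_ge0.
    - by apply: is_cvg_geometric_series; rewrite ger0_norm.
  rewrite telescopeK => /cvg_ex[l hl]; exists (l + a 0%N).
  have -> : a = (fun m => (a m - a 0%N) + a 0%N) by apply/funext => m; rewrite subrK.
  by rewrite subrK; apply: cvgD => //; apply: cvg_cst.
have [a ha] : exists l : R, (fun m => complex.Re (u m)) @ \oo --> l.
  apply: real_cvg => m; apply: le_trans (hu m).
  by rewrite -raddfB; apply: cmod_ge_Re.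
have [b hb] : exists l : R, (fun m => complex.Im (u m)) @ \oo --> l.
  apply: real_cvg => m; apply: le_trans (hu m).
  by rewrite -raddfB; apply: cmod_ge_Im.
exists (a +i* b); apply/tendsP => e e0.
have e20 : 0 < e / 2 by rewrite divr_gt0.
have [N1 _ h1] := (cvgrPdist_lt _ _).1 ha _ e20.
have [N2 _ h2] := (cvgrPdist_lt _ _).1 hb _ e20.
exists (maxn N1 N2) => m; rewrite geq_max => /andP[m1 m2].
have := h1 m m1; have := h2 m m2; rewrite /= => i1 i2.
apply: le_lt_trans (cmod_le_ReIm _) _.
have -> : complex.Re (u m - (a +i* b)) = complex.Re (u m) - a by case: (u m).
have -> : complex.Im (u m - (a +i* b)) = complex.Im (u m) - b by case: (u m).
by rewrite distrC [`|_ - b|]distrC; lra.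
Qed.

End ComplexLimits.

(** * Dominated convergence for sums over the integers *)

Section GeometricDomination.
Variable R : realType.

Lemma geometric_sum_le (s : R) n : 0 <= s < 1 -> \sum_(i < n) s ^+ i <= (1 - s)^-1.
Proof.
move=> /andP[s0 s1]; rewrite -[leRHS]mul1r ler_pdivlMr ?subr_gt0 //.
have -> : (\sum_(i < n) s ^+ i) * (1 - s) = 1 - s ^+ n.
  elim: n => [|n IH]; first by rewrite big_ord0 mul0r subrr.
  by rewrite big_ord_recr /= mulrDl IH exprSr; ring.
by rewrite gerBl exprn_ge0.
Qed.

Lemma geometric_small (s c e : R) : 0 <= s < 1 -> 0 < e -> exists J, c * s ^+ J < e.
Proof.
move=> /andP[s0 s1] e0; have sn : `|s| < 1 by rewrite ger0_norm.
have /cvgrPdist_lt /(_ e e0) [J _ hJ] := @cvg_geometric R c s sn.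
exists J; have := hJ J (leqnn J); rewrite /= /geometric sub0r normrN.
by apply: le_lt_trans; apply: ler_norm.
Qed.

Lemma dominated_sum_le (c : nat -> R) (K s : R) J n : 0 <= s < 1 ->
  (forall i, 0 <= c i <= K * s ^+ i) ->
  \sum_(i < n) c i <= \sum_(i < J) c i + K * s ^+ J / (1 - s).
Proof.
move=> s01 hc; have [s0 s1] := andP s01.
have K0 : 0 <= K by have /andP[h1 h2] := hc 0%N; move: h2; rewrite expr0 mulr1; apply: le_trans.
have t0 : 0 <= K * s ^+ J / (1 - s).
  by rewrite !mulr_ge0 ?exprn_ge0 // invr_ge0 subr_ge0 ltW.
have [nJ|Jn] := leqP n J.
  rewrite -(subnKC nJ) big_split_ord /= -addrA lerDl addr_ge0 //.
    by apply: sumr_ge0 => i _; have /andP[] := hc (n + i)%N.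
  by rewrite subnKC.
rewrite -(subnKC (ltnW Jn)) big_split_ord /= lerD2l.
apply: (@le_trans _ _ (\sum_(i < n - J) K * s ^+ J * s ^+ i)).
  by apply: ler_sum => i _; rewrite -mulrA -exprD; have /andP[] := hc (J + i)%N.
rewrite -mulr_sumr; apply: ler_wpM2l; first by rewrite mulr_ge0 ?exprn_ge0.
exact: geometric_sum_le.
Qed.

(** The head of the sum tends to 0 termwise and the tail is small by domination. *)
Lemma tannery (h : nat -> nat -> R[i]) (K s : R) (n : nat -> nat) : 0 <= s < 1 ->
  (forall m i, cmod (h m i) <= K * s ^+ i) ->
  (forall i, tends (h^~ i) 0) -> tends (fun m => \sum_(i < n m) h m i) 0.
Proof.
move=> s01 hb h0; have [s0 s1] := andP s01.
have fin J : forall d : R, 0 < d -> exists N, forall m, (N <= m)%N -> \sum_(i < J) cmod (h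
    m i) < d.
  elim: J => [|J IH] d d0; first by exists 0%N => m _; rewrite big_ord0.
  have d20 : 0 < d / 2 by rewrite divr_gt0.
  have [N1 h1] := IH _ d20; have [N2 h2] := (tendsP _ _).1 (h0 J) _ d20.
  exists (maxn N1 N2) => m; rewrite geq_max => /andP[m1 m2].
  rewrite big_ord_recr /=; have := h1 m m1; have := h2 m m2; rewrite subr0; lra.
apply/tendsP => e e0; have e20 : 0 < e / 2 by rewrite divr_gt0.
have [J hJ] := geometric_small (K / (1 - s)) s01 e20.
have [N hN] := fin J _ e20; exists N => m Nm; rewrite subr0.
apply: le_lt_trans (cmod_sum _ _ _) _.
have := @dominated_sum_le (fun i => cmod (h m i)) K s J (n m) s01.
have hc i : 0 <= cmod (h m i) <= K * s ^+ i by rewrite cmod_ge0 hb.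
move=> /(_ hc); have := hN m Nm; move: hJ; rewrite mulrAC.
set a := \sum_(i < J) _; set b := \sum_(i < n m) _; lra.
Qed.

Lemma zsum_fold (f : int -> R[i]) m :
  zsum m f = f 0 + \sum_(i < m) (f i.+1%:Z + f (- i.+1%:Z)).
Proof.
elim: m => [|m IH]; first by rewrite zsum0 big_ord0 addr0.
by rewrite zsumS IH big_ord_recr /=; ring.
Qed.

Lemma fold_le (f : int -> R[i]) (K s : R) : 0 <= s < 1 ->
  (forall k, cmod (f k) <= K * s ^+ `|k|%N) ->
  forall i : nat, cmod (f i.+1%:Z + f (- i.+1%:Z)) <= 2 * K * s ^+ i.
Proof.
move=> /andP[s0 s1] hf i; apply: le_trans (cmodD _ _) _.
have := hf i.+1%:Z; have := hf (- i.+1%:Z); rewrite abszN absz_nat exprS => h1 h2.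
have x0 : 0 <= K * s ^+ i.
  have K0 : 0 <= K by have := hf 0; rewrite absz0 expr0 mulr1; apply: le_trans (cmod_ge0 _).
  by rewrite mulr_ge0 // exprn_ge0.
have : K * (s * s ^+ i) <= K * s ^+ i by rewrite mulrCA ler_piMl // ltW.
lra.
Qed.

Lemma zsum_le (f : int -> R[i]) (K s : R) m : 0 <= s < 1 ->
  (forall k, cmod (f k) <= K * s ^+ `|k|%N) ->
  cmod (zsum m f) <= K + 2 * K / (1 - s).
Proof.
move=> s01 hf; rewrite zsum_fold; apply: le_trans (cmodD _ _) _; apply: lerD.
  by have := hf 0; rewrite absz0 expr0 mulr1.
apply: le_trans (cmod_sum _ _ _) _.
have hc i : 0 <= cmod (f i.+1%:Z + f (- i.+1%:Z)) <= 2 * K * s ^+ i.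
  by rewrite cmod_ge0 fold_le.
have := @dominated_sum_le (fun i => cmod (f i.+1%:Z + f (- i.+1%:Z))) (2 * K) s 0 m s01 hc.
by rewrite big_ord0 add0r expr0 mulr1.
Qed.

Lemma tannery_zsum (F : nat -> int -> R[i]) (K s : R) (n : nat -> nat) : 0 <= s < 1 ->
  (forall m k, cmod (F m k) <= K * s ^+ `|k|%N) ->
  (forall k, tends (F^~ k) 0) -> tends (fun m => zsum (n m) (F m)) 0.
Proof.
move=> s01 hb h0.
have h i : tends (fun m => F m i.+1%:Z + F m (- i.+1%:Z)) 0.
  by have := tendsD (h0 i.+1%:Z) (h0 (- i.+1%:Z)); rewrite addr0.
have := tendsD (h0 0) (tannery n s01 (fun m => fold_le s01 (hb m)) h).
by rewrite addr0; apply: (tends_ev (N := 0)) => m _; rewrite zsum_fold.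
Qed.

Lemma tannery_zsum2 (F : nat -> int -> int -> R[i]) (K s : R) (n : nat -> nat) : 0 <= s < 1 ->
  (forall m t u, cmod (F m t u) <= K * s ^+ `|t|%N * s ^+ `|u|%N) ->
  (forall t u, tends (fun m => F m t u) 0) ->
  tends (fun m => zsum (n m) (fun t => zsum (n m) (F m t))) 0.
Proof.
move=> s01 hb h0.
apply: (tannery_zsum (F := fun m t => zsum (n m) (F m t)) (K := K + 2 * K / (1 - s)) n s01).
  move=> m t; apply: le_trans (zsum_le _ s01 (hb m t)) _.
  by rewrite le_eqVlt; apply/orP; left; apply/eqP; ring.
by move=> t; apply: (tannery_zsum (K := K * s ^+ `|t|%N) n s01).
Qed.

(** Quadratic exponents win: [s ^+ i.-1 * Y * 2] is eventually at most 1. *)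
Lemma gaussian_le_geometric (s Y : R) : 0 <= s < 1 -> 0 <= Y ->
  exists K, forall i e : nat, (i * i.-1 <= e)%N -> s ^+ e * Y ^+ i <= K * (2^-1) ^+ i.
Proof.
move=> s01 Y0; have [s0 s1] := andP s01.
have [J hJ] := geometric_small (Y * 2) s01 ltr01.
exists (1 + \sum_(i < J.+1) (Y * 2) ^+ i) => i e ie.
have b0 k : 0 <= (Y * 2) ^+ k by rewrite exprn_ge0 // mulr_ge0.
have se : s ^+ e * Y ^+ i <= s ^+ (i * i.-1) * Y ^+ i.
  by apply: ler_wpM2r; [rewrite exprn_ge0 | apply: ler_wiXn2l => //; apply: ltW].
apply: le_trans se _.
rewrite -[Y in Y ^+ i](mulfK (x := 2)) // exprMn mulrA; apply: ler_wpM2r; first by rewrite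
    exprn_ge0.
have S0 : 0 <= \sum_(k < J.+1) (Y * 2) ^+ k by apply: sumr_ge0.
have [Ji|iJ] := ltnP J i.
  have : s ^+ (i * i.-1) * (Y * 2) ^+ i <= 1; last by lra.
  rewrite mulnC exprM -exprMn; apply: exprn_ile1.
    by rewrite mulr_ge0 ?exprn_ge0 // mulr_ge0.
  rewrite mulrC; apply: le_trans (ltW hJ); apply: ler_wpM2l; first by rewrite mulr_ge0.
  by apply: ler_wiXn2l; rewrite ?(ltW s1) //; case: (i) Ji.
have : s ^+ (i * i.-1) * (Y * 2) ^+ i <= (Y * 2) ^+ i.
  by rewrite ler_piMl // exprn_ile1 // ltW.
have : (Y * 2) ^+ i <= \sum_(k < J.+1) (Y * 2) ^+ k.
  rewrite (bigD1 (Ordinal (iJ : (i < J.+1)%N))) //= lerDl; exact: sumr_ge0.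
lra.
Qed.

End GeometricDomination.

(** * The theta function *)

Section ThetaFunction.
Variables (R : realType) (p : R[i]).
Hypothesis p_lt1 : `|p| < 1.

Let r : R := cmod p.

Lemma cmod_p_lt1 : 0 <= r < 1.
Proof. by rewrite cmod_ge0 -ltcR -cmodE. Qed.

Lemma p_pow_neq1 i : 1 - p ^+ i.+1 != 0.
Proof.
have /andP[r0 r1] := cmod_p_lt1.
rewrite subr_eq0; apply/eqP => /(congr1 (@cmod R)).
rewrite cmod1 cmodX => e; have : r ^+ i.+1 < 1 by rewrite exprn_ilt1.
by rewrite -e ltxx.
Qed.

Lemma fpoch_le a m : cmod (fpoch p a m) <= expR (cmod a / (1 - r)).
Proof.
have /andP[r0 r1] := cmod_p_lt1.
apply: (@le_trans _ _ (expR (cmod a * \sum_(i < m) r ^+ i))); last first.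
  by rewrite ler_expR; apply: ler_wpM2l; [exact: cmod_ge0 | exact: geometric_sum_le cmod_p_lt1].
elim: m => [|m IH]; first by rewrite /fpoch !big_ord0 mulr0 expR0 cmod1.
rewrite fpochSr cmodM big_ord_recr /= mulrDr expRD; apply: ler_pM => //; try exact: cmod_ge0.
apply: le_trans (expR_ge1Dx _); apply: le_trans (cmodD _ _) _.
by rewrite cmod1 cmodN cmodM cmodX.
Qed.

Lemma fpoch_cvg a : exists l, tends (fpoch p a) l.
Proof.
apply: (tends_geometric (K := expR (cmod a / (1 - r)) * cmod a) cmod_p_lt1) => m.
have -> : fpoch p a m.+1 - fpoch p a m = - (fpoch p a m * (a * p ^+ m)).
  by rewrite fpochSr; ring.
rewrite cmodN !cmodM cmodX mulrA; apply: ler_wpM2r; first by rewrite exprn_ge0 ?cmod_ge0.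
by apply: ler_wpM2r; [exact: cmod_ge0 | exact: fpoch_le].
Qed.

(** The infinite product [(a; p)_oo], in terms of which theta is
    [ipoch a * ipoch (p / a)] by [thetaE]. *)
Definition ipoch (a : R[i]) : R[i] := limn (fpoch p a : nat -> R[i]^o).

Lemma fpoch_tends a : tends (fpoch p a) (ipoch a).
Proof. by have [l hl] := fpoch_cvg a; rewrite /ipoch (tends_lim hl). Qed.

Lemma ipoch_rec a : ipoch a = (1 - a) * ipoch (p * a).
Proof.
have h1 : tends (fun m => fpoch p a m.+1) (ipoch a).
  exact: (tends_sub (s := S) (fun N => ex_intro _ N (fun m (h : (N <= m)%N) => leqW h))
      (fpoch_tends a)).
apply: (tends_uniq h1).
have := tendsM (tends_cst (1 - a)) (fpoch_tends (p * a)).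
by apply: (tends_ev (N := 0)) => m _; rewrite fpochSl.
Qed.

Lemma ipoch_split a J : ipoch a = fpoch p a J * ipoch (p ^+ J * a).
Proof.
elim: J => [|J IH]; first by rewrite /fpoch big_ord0 mul1r expr0 mul1r.
rewrite IH fpochSr [ipoch (p ^+ J * a)]ipoch_rec -mulrA [p ^+ J * a]mulrC.
by congr (_ * (_ * ipoch _)); rewrite exprS; ring.
Qed.

Lemma fpoch_ge b m : cmod b / (1 - r) <= 1 ->
  1 - cmod b * \sum_(i < m) r ^+ i <= cmod (fpoch p b m).
Proof.
have /andP[r0 r1] := cmod_p_lt1 => hb.
have part k : cmod b * \sum_(i < k) r ^+ i <= 1.
  apply: le_trans hb; apply: ler_wpM2l; [exact: cmod_ge0 | exact: geometric_sum_le cmod_p_lt1].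
have nn k : 0 <= \sum_(i < k) r ^+ i by apply: sumr_ge0 => i _; apply: exprn_ge0.
elim: m => [|m IH]; first by rewrite /fpoch !big_ord0 mulr0 subr0 cmod1.
rewrite fpochSr big_ord_recr /= mulrDr cmodM.
have h1 : 1 - cmod b * r ^+ m <= cmod (1 - b * p ^+ m).
  have := cmodD (1 - b * p ^+ m) (b * p ^+ m); rewrite subrK cmod1 cmodM cmodX -/r; lra.
have x0 : 0 <= cmod b * r ^+ m by rewrite mulr_ge0 ?cmod_ge0 ?exprn_ge0.
have y0 : 0 <= cmod b * \sum_(i < m) r ^+ i by rewrite mulr_ge0 ?cmod_ge0.
have := part m; have := part m.+1; rewrite big_ord_recr /= mulrDr.
move: IH h1 x0 y0; set X := cmod _; set Y := cmod (1 - _).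
set s := _ * r ^+ m; set S := _ * \sum_(i < m) _ => IH h1 x0 y0 p1 p2.
apply: (@le_trans _ _ ((1 - S) * (1 - s))).
  have : 0 <= S * s by rewrite mulr_ge0.
  lra.
by apply: ler_pM => //; lra.
Qed.

(** After finitely many factors, which do not vanish, the partial products of the
    remaining ones have modulus at least 1/2. *)
Lemma ipoch_neq0 a : (forall l, a * p ^+ l != 1) -> ipoch a != 0.
Proof.
have /andP[r0 r1] := cmod_p_lt1 => ha.
have h20 : 0 < 2^-1 :> R by rewrite invr_gt0.
have [J hJ] := geometric_small (cmod a / (1 - r)) cmod_p_lt1 h20.
rewrite (ipoch_split a J) mulf_neq0 //.
  by apply/prodf_neq0 => l _; rewrite subr_eq0 eq_sym.
set b := p ^+ J * a.
have hb : cmod b / (1 - r) <= 2^-1.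
  by rewrite /b cmodM cmodX -/r -mulrA mulrC ltW.
apply/eqP => b0; have := fpoch_tends b; rewrite b0 => /tendsP /(_ _ h20) [N hN].
have := hN N (leqnn N); rewrite subr0.
have := @fpoch_ge b N; have : cmod b * \sum_(i < N) r ^+ i <= cmod b / (1 - r).
  by apply: ler_wpM2l; [exact: cmod_ge0 | exact: geometric_sum_le cmod_p_lt1].
set X := cmod (fpoch _ _ _); set S := _ * \sum_(i < N) _.
move=> h1 h2 h3; have /h2 : cmod b / (1 - r) <= 1 by lra.
lra.
Qed.

Lemma fin_theta_tends a : tends (fun m => fin_theta p m a) (ipoch a * ipoch (p / a)).
Proof.
apply: (tends_ev (N := 0)) (tendsM (fpoch_tends a) (fpoch_tends (p / a))) => m _.
by rewrite fin_thetaE.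
Qed.

Lemma thetaE a : theta p a = ipoch a * ipoch (p / a).
Proof. exact: tends_lim (fin_theta_tends a). Qed.

Lemma theta_1 : theta p 1 = 0.
Proof. by rewrite thetaE ipoch_rec subrr !mul0r. Qed.

Lemma theta_inv a : a != 0 -> theta p a^-1 = - (a^-1 * theta p a).
Proof.
move=> a0; rewrite !thetaE invrK [ipoch a^-1]ipoch_rec [ipoch a]ipoch_rec.
by field.
Qed.

Lemma theta_p_shift a : p != 0 -> a != 0 -> theta p (p * a) = - (a^-1 * theta p a).
Proof.
move=> p0 a0; rewrite !thetaE invfM mulrA divff // mul1r.
by rewrite [ipoch a^-1]ipoch_rec [ipoch a]ipoch_rec; field.
Qed.

Lemma theta_zero a : a != 0 -> theta p a = 0 -> exists k : int, a = p ^ k.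
Proof.
move=> a0 /eqP; rewrite thetaE mulf_eq0 => /orP[] z.
  have [[l hl]|no] := pselect (exists l, a * p ^+ l = 1).
    exists (- l%:Z); rewrite -invr_expz -exprnP; apply: (mulIf (x := p ^+ l)).
      by apply: contra_eq_neq hl => ->; rewrite mulr0 eq_sym oner_neq0.
    rewrite hl mulVf //.
    by apply: contra_eq_neq hl => ->; rewrite mulr0 eq_sym oner_neq0.
  by move: z; rewrite (negPf (ipoch_neq0 _)) // => l; apply/eqP => h; apply: no; exists l.
have [[l hl]|no] := pselect (exists l, p / a * p ^+ l = 1).
  by exists l.+1%:Z; rewrite -exprnP exprS -[LHS]mulr1 -hl; field.
by move: z; rewrite (negPf (ipoch_neq0 _)) // => l; apply/eqP => h; apply: no; exists l.
Qed.

(** The multiplier for [c = p ^ k] is found by iterating [theta_p_shift]; the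
    exponent of [x] is [- k].  For [p = 0] the only zero is 1. *)
Lemma theta_quasi c : c != 0 -> theta p c = 0 ->
  exists phi (kappa : int), [/\ phi != 0, phi ^+ 2 = c ^ (kappa + 1) &
    forall x, x != 0 -> theta p (c * x) = phi * x ^ kappa * theta p x].
Proof.
move=> c0 tc; have [k ck] := theta_zero c0 tc.
pose quasi c := exists phi (kappa : int), [/\ phi != 0, phi ^+ 2 = c ^ (kappa + 1) &
    forall x, x != 0 -> theta p (c * x) = phi * x ^ kappa * theta p x].
have quasiV d : d != 0 -> quasi d -> quasi d^-1.
  move=> d0 [phi [ka [phi0 phiE h]]]; exists (phi^-1 * d ^ ka), (- ka); split.
  - by rewrite mulf_neq0 ?invr_eq0 ?expfz_neq0.
  - rewrite exprMn exprVn phiE [d^-1 ^ _]exprz_inv opprD opprK.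
    rewrite !expfzDr // expr1z [d ^ (-1)](_ : _ = d^-1) //; field.
    by rewrite d0 expfz_neq0.
  move=> x x0; have := h (d^-1 * x); rewrite mulVKf // => -> //; last by rewrite mulf_neq0
      ?invr_eq0.
  rewrite expfzMl exprz_inv -!invr_expz; field.
  by rewrite phi0 !expfz_neq0.
have quasi1 : quasi 1.
  exists 1, 0; rewrite oner_neq0 expr1n exp1rz; split=> // x x0.
  by rewrite expr0z !mul1r.
have quasi_pow (l : nat) : p != 0 -> quasi (p ^+ l).
  move=> p0; have [phi [phi0 phiE h]] : exists phi, [/\ phi != 0,
      phi ^+ 2 = p ^ (l%:Z * (1 - l%:Z)) &
      forall x, x != 0 -> theta p (p ^+ l * x) = phi * x ^ (- l%:Z) * theta p x].
    elim: l => [|l [phi [phi0 phiE h]]].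
      by exists 1; rewrite oner_neq0 expr1n mul0r; split=> // x x0; rewrite expr0z expr0 !mul1r.
    exists (- (p ^- l * phi)); split.
    - by rewrite oppr_eq0 mulf_neq0 ?invr_eq0 ?expf_neq0.
    - rewrite sqrrN exprMn phiE -exprVn -exprM.
      rewrite (_ : l.+1%:Z * (1 - l.+1%:Z) = - (l * 2)%N%:Z + l%:Z * (1 - l%:Z)); last lia.
      by rewrite expfzDr // -invr_expz -exprnP exprVn.
    move=> x x0; rewrite exprS -mulrA theta_p_shift ?mulf_neq0 ?expf_neq0 // h //.
    rewrite (_ : - l.+1%:Z = - l%:Z - 1); last lia.
    rewrite expfzDr // [x ^ (- 1)](_ : _ = x^-1) //; field.
    by rewrite x0 expf_neq0.
  exists phi, (- l%:Z); split=> //; rewrite phiE exprnP exprz_exp; congr (_ ^ (_ * _)); lia.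
have [p0|p0] := eqVneq p 0.
  suff -> : c = 1 by exact: quasi1.
  move: c0; rewrite ck p0; case: (k) => [[|l]|l].
  - by rewrite expr0z.
  - by rewrite -exprnP expr0n eqxx.
  - by rewrite NegzE -invr_expz -exprnP expr0n invr0 eqxx.
rewrite ck; case: (k) => l; first exact: quasi_pow.
by rewrite NegzE -invr_expz -exprnP; apply: quasiV; [rewrite expf_neq0 | exact: quasi_pow].
Qed.

Lemma ipoch_p_neq0 : ipoch p != 0.
Proof.
by apply: ipoch_neq0 => l; rewrite -exprS eq_sym -subr_eq0 p_pow_neq1.
Qed.

Let L := (ipoch p)^-1.

Lemma inv_poch_tends k : tends (fun m => inv_poch p (m%:Z + k)) L.
Proof.
have hs : forall N, exists M, forall m, (M <= m)%N -> (N <= absz (m%:Z + k)%R)%N.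
  by move=> N; exists (N + `|k|)%N => m; lia.
have := tendsV ipoch_p_neq0 (tends_sub hs (fpoch_tends p)).
apply: (tends_ev (N := `|k|%N)) => m km.
by rewrite (_ : m%:Z + k = absz (m%:Z + k)) //; lia.
Qed.

Lemma gauss_bin_tends k : tends (fun m => gauss_bin p m k) L.
Proof.
have hs : forall N, exists M, forall m, (M <= m)%N -> (N <= m.*2)%N.
  by move=> N; exists N => m; lia.
have := tendsM (tendsM (tends_sub hs (fpoch_tends p)) (inv_poch_tends k)) (inv_poch_tends
    (- k)).
by rewrite divff ?ipoch_p_neq0 // mul1r.
Qed.

Lemma gauss_bin_bounded : exists B, forall m k, cmod (gauss_bin p m k) <= B.
Proof.
have [B1 h1] := tends_bounded (fpoch_tends p).
have [B2 h2] := tends_bounded (tendsV ipoch_p_neq0 (fpoch_tends p)).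
have h3 k : cmod (inv_poch p k) <= B2.
  by case: k => [k|k]; [exact: h2 | rewrite /inv_poch cmod0; apply: le_trans (h2 0%N);
      exact: cmod_ge0].
exists (B1 * B2 * B2) => m k; rewrite /gauss_bin !cmodM.
by do !apply: ler_pM; rewrite ?mulr_ge0 ?cmod_ge0.
Qed.

Lemma cmodXz (x : R[i]) (k : int) : cmod (x ^ k) = cmod x ^ k.
Proof. by case: k => k; rewrite ?NegzE -?invr_expz -!exprnP ?cmodV cmodX. Qed.

Lemma weight_le (e : int -> nat) (x : R[i]) : x != 0 ->
  (forall t : int, (`|t| * `|t|.-1 <= e t)%N) ->
  exists K, forall t : int, cmod (p ^+ e t * x ^ (t * 2)) <= K * 2^-1 ^+ `|t|%N.
Proof.
move=> x0 he; have X0 : 0 < cmod x by rewrite lt_neqAle eq_sym cmod_eq0 x0 cmod_ge0.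
pose Y := cmod x ^+ 2 + (cmod x)^-1 ^+ 2.
have Xp : 0 <= cmod x ^+ 2 by rewrite exprn_ge0 // ltW.
have Xn : 0 <= (cmod x)^-1 ^+ 2 by rewrite exprn_ge0 // invr_ge0 ltW.
have Y0 : 0 <= Y by rewrite addr_ge0.
have [K hK] := gaussian_le_geometric cmod_p_lt1 Y0.
exists K => t; apply: le_trans (hK _ _ (he t)).
rewrite cmodM cmodX cmodXz; apply: ler_wpM2l; first by rewrite exprn_ge0 // cmod_ge0.
case: t => t /=.
  rewrite mulrC -exprz_exp -!exprnP; apply: lerXn2r; rewrite ?nnegrE //.
  by rewrite /Y lerDl.
rewrite NegzE mulNr -invr_expz mulrC -exprz_exp -!exprnP -!exprVn.
by apply: lerXn2r; rewrite ?nnegrE // /Y lerDr.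
Qed.

Lemma even_weight_le x : x != 0 ->
  exists K, forall t, cmod (even_weight p x t) <= K * 2^-1 ^+ `|t|%N.
Proof. by move=> x0; apply: weight_le => // t; rewrite /sq_int; nia. Qed.

Lemma odd_weight_le x : x != 0 ->
  exists K, forall t, cmod (odd_weight p x t) <= K * 2^-1 ^+ `|t|%N.
Proof.
move=> x0; have [|K hK] := @weight_le pronic x x0.
  by move=> t; rewrite /pronic; case: t => t; nia.
exists (K * cmod x) => t; rewrite /odd_weight expfzDr // expr1z mulrA cmodM mulrAC.
by apply: ler_wpM2r; rewrite ?cmod_ge0.
Qed.

Definition even_sum (m : nat) (x : R[i]) : R[i] := zsum m.*2.+1 (even_weight p x).
Definition odd_sum (m : nat) (x : R[i]) : R[i] := zsum m.*2.+1 (odd_weight p x).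
(** [L] is the limit of all the coefficients [gauss_bin p m k]. *)
Definition theta_det (m : nat) (x y : R[i]) : R[i] :=
  L ^+ 2 * (x * (odd_sum m x * even_sum m y - even_sum m x * odd_sum m y)).

Lemma zsum_mul (f h : int -> R[i]) n : zsum n f * zsum n h = zsum n (fun t => zsum n (fun u
    => f t * h u)).
Proof. by rewrite /zsum mulr_suml; apply: eq_bigr => i _; rewrite mulr_sumr. Qed.

Lemma zsumZ (c : R[i]) (f : int -> R[i]) n : c * zsum n f = zsum n (fun t => c * f t).
Proof. exact: mulr_sumr. Qed.

(** Replacing both Gaussian binomials in [finite_theta_pair] by their limit
    changes the double sum by a quantity that tends to 0, by dominated
    convergence. *)
Lemma theta_det_tends x y : x != 0 -> y != 0 ->
  tends (fun m => theta_det m x y) (theta p (x * y) * theta p (x / y)).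
Proof.
move=> x0 y0.
have [K1 h1] := odd_weight_le x0; have [K2 h2] := even_weight_le y0.
have [K3 h3] := even_weight_le x0; have [K4 h4] := odd_weight_le y0.
have [B hB] := gauss_bin_bounded.
have half : 0 <= (2^-1 : R) < 1 by rewrite invr_ge0 ler0n /= invf_lt1 ?ltr1n.
have half_ge0 k : 0 <= (2^-1 : R) ^+ k by rewrite exprn_ge0 // invr_ge0.
pose c m (k l : int) := gauss_bin p m k * gauss_bin p m l - L ^+ 2.
have c0 k l : tends (fun m => c m k l) 0.
  rewrite -(subrr (L ^+ 2)); apply: tendsB; last exact: tends_cst.
  by rewrite expr2; apply: tendsM; exact: gauss_bin_tends.
have cB m k l : cmod (c m k l) <= B * B + cmod (L ^+ 2).
  apply: le_trans (cmodD _ _) _; rewrite cmodN; apply: lerD => //.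
  by rewrite cmodM; apply: ler_pM; rewrite ?cmod_ge0.
have C0 : 0 <= B * B + cmod (L ^+ 2) by apply: le_trans (cB 0%N 0 0); exact: cmod_ge0.
move: (B * B + _) cB C0 => C cB C0.
pose F m t u := c m (t + u + 1) (t + 1 - u) * (x * odd_weight p x t * even_weight p y u) -
   c m (t + u + 1) (t - u) * (x * even_weight p x t * odd_weight p y u).
have dom (w w' : int -> R[i]) Ka Kb m k l t u :
    (forall t, cmod (w t) <= Ka * 2^-1 ^+ `|t|%N) -> (forall t, cmod (w' t) <= Kb * 2^-1 ^+
        `|t|%N) ->
    cmod (c m k l * (x * w t * w' u)) <= (C * cmod x * Ka * Kb) * 2^-1 ^+ `|t|%N * 2^-1 ^+
        `|u|%N.
  move=> ha hb; rewrite !cmodM.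
  have -> : C * cmod x * Ka * Kb * 2^-1 ^+ `|t|%N * 2^-1 ^+ `|u|%N =
     C * (cmod x * (Ka * 2^-1 ^+ `|t|%N) * (Kb * 2^-1 ^+ `|u|%N)) by ring.
  apply: ler_pM; rewrite ?mulr_ge0 ?cmod_ge0 //; apply: ler_pM; rewrite ?mulr_ge0 ?cmod_ge0 //.
  by apply: ler_wpM2l; rewrite ?cmod_ge0.
have lim0 : tends (fun m => zsum m.*2.+1 (fun t => zsum m.*2.+1 (F m t))) 0.
  apply: (tannery_zsum2 (K := C * cmod x * K1 * K2 + C * cmod x * K3 * K4) (fun m =>
      m.*2.+1) half).
    move=> m t u; apply: le_trans (cmodD _ _) _; rewrite cmodN.
    rewrite [leRHS](_ : _ = C * cmod x * K1 * K2 * 2^-1 ^+ `|t|%N * 2^-1 ^+ `|u|%N +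
      C * cmod x * K3 * K4 * 2^-1 ^+ `|t|%N * 2^-1 ^+ `|u|%N); last by ring.
    by apply: lerD; apply: dom.
  move=> t u; rewrite -(subr0 0) -{1}(mul0r (x * odd_weight p x t * even_weight p y u)).
  rewrite -{2}(mul0r (x * even_weight p x t * odd_weight p y u)).
  by apply: tendsB; apply: tendsM => //; exact: tends_cst.
have lim := tendsB (tendsM (fin_theta_tends (x * y)) (fin_theta_tends (x / y))) lim0.
rewrite -!thetaE subr0 in lim; apply: (tends_ev (N := 0) _ lim) => m _.
rewrite (finite_theta_pair p_pow_neq1) // -zsumN -zsumD /theta_det.
rewrite /odd_sum /even_sum !zsum_mul -zsumN -zsumD !zsumZ.
apply: eq_in_zsum => t _; rewrite -!zsumN -!zsumD !zsumZ.
apply: eq_in_zsum => u _; rewrite /F /c; ring.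
Qed.

Lemma theta_weierstrass x y u v : x != 0 -> y != 0 -> u != 0 -> v != 0 ->
  theta p (x * y) * theta p (x / y) * (theta p (u * v) * theta p (u / v)) -
  theta p (x * v) * theta p (x / v) * (theta p (u * y) * theta p (u / y)) =
  u / y * (theta p (y * v) * theta p (y / v) * (theta p (x * u) * theta p (x / u))).
Proof.
move=> x0 y0 u0 v0.
apply: (@tends_uniq R (fun m => theta_det m x y * theta_det m u v - theta_det m x v *
    theta_det m u y)).
  by apply: tendsB; apply: tendsM; apply: theta_det_tends.
have lim := tendsM (tends_cst (u / y)) (tendsM (theta_det_tends y0 v0) (theta_det_tends x0 u0)).
apply: (tends_ev (N := 0) (u := fun m => u / y * (theta_det m y v * theta_det m x u)) _
    lim) => m _.
rewrite /theta_det; move: L (odd_sum m x) (odd_sum m y) (odd_sum m u) (odd_sum m v).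
move: (even_sum m x) (even_sum m y) (even_sum m u) (even_sum m v).
move=> ex ey eu ev l ox oy ou ov.
by field.
Qed.

Theorem theta_theta_like : theta_like (theta p).
Proof.
split; [exact: theta_1 | exact: theta_inv | exact: theta_quasi |].
move=> z b b' u v z0 b0 b'0 u0 v0.
(* The square root of b b' takes z / b and z / b' to the form x y and x / y. *)
have [m mE] : exists m : R[i], m ^+ 2 = b * b' by exists (sqrtc (b * b')); rewrite sqr_sqrtc.
have m0 : m != 0 by apply: contraTneq (mulf_neq0 b0 b'0) => m0; rewrite -mE m0 expr0n eqxx.
have b'E : b' = m ^+ 2 / b by rewrite mE mulrAC divff ?mul1r.
have bm0 : m ^+ 2 / b != 0 by rewrite -b'E.
have := @theta_weierstrass (z / m) (m / b) (v / m) (u / m).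
rewrite !mulf_neq0 ?invr_eq0 // => /(_ isT isT isT isT).
rewrite b'E.
have -> : z / m * (m / b) = z / b by field; rewrite b0 m0.
have -> : z / m / (m / b) = z / (m ^+ 2 / b) by field; rewrite b0 m0.
have -> : v / m * (u / m) = u * v / (b * (m ^+ 2 / b)) by field; rewrite b0 m0.
have -> : v / m / (u / m) = v / u by field; rewrite u0 m0.
have -> : z / m * (u / m) = z * u / (b * (m ^+ 2 / b)) by field; rewrite b0 m0.
have -> : z / m / (u / m) = z / u by field; rewrite u0 m0.
have -> : v / m * (m / b) = v / b by field; rewrite b0 m0.
have -> : v / m / (m / b) = v / (m ^+ 2 / b) by field; rewrite b0 m0.
have -> : m / b * (u / m) = u / b by field; rewrite b0 m0.
have -> : m / b / (u / m) = (u / (m ^+ 2 / b))^-1 by field; rewrite b0 m0 u0.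
have -> : z / m * (v / m) = z * v / (b * (m ^+ 2 / b)) by field; rewrite b0 m0.
have -> : z / m / (v / m) = z / v by field; rewrite v0 m0.
rewrite theta_inv; last by apply: mulf_neq0 => //; rewrite invr_eq0.
move=> W.
apply/eqP; rewrite -subr_eq0; apply/eqP; move/eqP: W; rewrite -subr_eq0 => /eqP <-.
by field; rewrite b0 m0 u0.
Qed.

End ThetaFunction.

(** * Sums over boxes of multi-indices *)

Section BoxIndices.
Variable n : nat.

Definition box (N : multi n) : finType := {dffun forall r : 'I_n, 'I_(N r).+1}.

Definition box_val (N : multi n) (k : box N) : multi n := [ffun r => k r : nat].

Lemma box_valE (N : multi n) (k : box N) r : box_val k r = k r.
Proof. by rewrite ffunE. Qed.

Lemma box_val_le (N : multi n) (k : box N) : Defs.lem (box_val k) N.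
Proof. by move=> r; rewrite box_valE -ltnS. Qed.

Lemma box_sum_sub (V : nmodType) (N k : multi n) (G : multi n -> V) : Defs.lem k N ->
  box_sum k G = \sum_(j : box N | [forall r, j r <= k r]%N) G (box_val j).
Proof.
move=> kN; rewrite /box_sum.
have lt (i : box k) r : (i r < (N r).+1)%N.
  by rewrite ltnS; apply: leq_trans (kN r); rewrite -ltnS.
rewrite [RHS](reindex_onto (fun i : box k => [ffun r => inord (i r)] : box N)
   (fun j : box N => [ffun r => inord (j r)] : box k)) /=; last first.
  move=> j /forallP jk; apply/ffunP => r; rewrite !ffunE; apply: val_inj.
  by rewrite /= inordK !inordK // ltnS.
apply: eq_big => [i|i _].
  symmetry; apply/andP; split.
    by apply/forallP => r; rewrite ffunE inordK // -ltnS.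
  by apply/eqP/ffunP => r; rewrite !ffunE; apply: val_inj; rewrite /= !inordK // inordK.
by congr G; apply/ffunP => r; rewrite !ffunE inordK.
Qed.

Lemma box_sum_exchange (V : nmodType) (N : multi n) (G : multi n -> multi n -> V) :
  box_sum N (fun k => box_sum k (G k)) =
  \sum_(j : box N) \sum_(k : box N | [forall r, j r <= k r]%N) G (box_val k) (box_val j).
Proof.
transitivity (\sum_(k : box N) \sum_(j : box N | [forall r, j r <= k r]%N)
    G (box_val k) (box_val j)); last by rewrite (exchange_big_dep xpredT).
apply: eq_bigr => k _; rewrite -/(box_val k) (box_sum_sub _ (box_val_le k)).
by apply: eq_bigl => j; apply: eq_forallb => r; rewrite box_valE.
Qed.

End BoxIndices.

(** * The transformed pair as a Jackson sum *)

Section Summand.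
Variables (R : realType) (n : nat) (q p : R[i]) (x : 'I_n -> R[i]).
Variables (rho1 rho2 a b : R[i]).
Hypotheses (n_gt0 : (0 < n)%N) (q0 : q != 0) (p_lt1 : `|p| < 1).
Hypotheses (x0 : forall r, x r != 0) (rho10 : rho1 != 0) (rho20 : rho2 != 0).
Hypothesis B3gen : B3_generic q p x a b.
Hypothesis Tgen : transf_generic q p x rho1 rho2 a b.
Variables (N j : multi n).
Hypothesis jN : Defs.lem j N.

(* With f, bh, ch, g, d and z as the parameters f, b, c, g, d and the variables
   of the Jackson summation, the sum over k for fixed j is that summation. *)
Local Notation th := (theta p).
Local Notation J := (wt j).
Local Notation b' := (shift_b q rho1 rho2 a b).
Local Notation f := (a * q / (rho1 * rho2)).
Local Notation bh := (rho1 * q ^+ J).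
Local Notation ch := (rho2 * q ^+ J).
Local Notation g := (a * q ^+ (2 * J).+1).
Local Notation M r := (N r - j r)%N.
Local Notation d := (f * q ^+ (\sum_r M r) / q).
Local Notation z := (fun r => b' * q ^+ (J + j r).+1 * x r).

Let a0 : a != 0. Proof. by have [] := B3gen. Qed.
Let b0 : b != 0. Proof. by have [] := B3gen. Qed.

Lemma qpfactE y k : qpfact q p y k%:Z = qf th q y k.
Proof. by []. Qed.

Lemma qpfact_sub y (k l : nat) : (l <= k)%N ->
  qpfact q p y (k%:Z - l%:Z) = qf th q y (k - l)%N.
Proof. by move=> lk; rewrite subzn. Qed.

Lemma qf_factor_neq0 y k i : qf th q y k != 0 -> (i < k)%N -> th (y * q ^+ i) != 0.
Proof. by move=> /prodf_neq0 h ik; apply: (h (Ordinal ik)). Qed.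

Lemma B3_den_neq0 k l : Defs.lem l k -> B3_den q p x k l a != 0.
Proof. by have [_ _ h] := B3gen; apply: h. Qed.

Lemma ratio_neq0 r s (k l : multi n) : Defs.lem l k ->
  qf th q (q ^ (1 + (l r)%:Z - (l s)%:Z) * x r / x s) (k r - l r) != 0.
Proof.
move=> lk; have := B3_den_neq0 lk; rewrite /B3_den mulf_eq0 negb_or => /andP[_ /prodf_neq0 h].
have /prodf_neq0 /(_ s isT) := h r isT.
by rewrite qpfact_sub.
Qed.

(** The genericity assumptions bear on products of theta values; choosing the
    multi-indices large enough makes each theta value needed one of the factors. *)
Lemma string_generic_z : string_generic th q z g.
Proof.
have r0 : 'I_n := Ordinal n_gt0.
have wt_const e : (e <= wt [ffun _ : 'I_n => e])%N.
  by rewrite /wt (bigD1 r0) //= ffunE leq_addr.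
split.
- by move=> r; rewrite !mulf_neq0 ?invr_eq0 ?mulf_neq0 ?expf_neq0 ?invr_eq0.
- move=> r s e rs.
  have -> : q ^ e * (b' * q ^+ (J + j r).+1 * x r) / (b' * q ^+ (J + j s).+1 * x s) =
     q ^ (e + (j r)%:Z - (j s)%:Z) * x r / x s.
    rewrite !expfzDr // -invr_expz -!exprnP -!addSn !exprD; field.
    by rewrite x0 !expf_neq0 // mulf_neq0 ?invr_eq0 ?mulf_neq0.
  set e' := e + _ - _.
  (* The multi-index l satisfies 1 + l r - l s = e'. *)
  pose l : multi n := [ffun t => if t == r then absz (e' + absz e') else (absz e').+1].
  have lk : Defs.lem l [ffun t => (l t).+1] by move=> t; rewrite [X in (_ <= X)%N]ffunE leqnSn.
  have sr : (s == r) = false by rewrite eq_sym; apply: negPf.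
  have := ratio_neq0 r s lk; rewrite !ffunE eqxx sr subSnn.
  have -> : 1 + (absz (e' + absz e'))%:Z - (absz e').+1%:Z = e' by lia.
  by move=> /qf_factor_neq0 /(_ (ltn0Sn 0)); rewrite expr0 mulr1.
- move=> r i; pose k : multi n := [ffun=> 0%N]; pose l : multi n := [ffun=> (J + j r + i).+1].
  have kl : Defs.lem k l by move=> t; rewrite !ffunE.
  have [_ _ _ _ /prodf_neq0 /(_ r isT)] := Tgen kl.
  have wk : wt k = 0%N by rewrite /wt big1 // => t _; rewrite ffunE.
  rewrite qpfactE wk add0n ffunE => /qf_factor_neq0 /(_ (ltnSn _)).
  have -> // : b * rho1 * rho2 * x r / a * q ^+ (J + j r + i) = b' * q ^+ (J + j r).+1 * x
      r * q ^+ i.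
  by rewrite /shift_b exprD exprS; field; rewrite a0 q0.
- move=> i; pose k : multi n := [ffun=> 0%N]; pose l : multi n := [ffun=> (2 * J + i).+1].
  have kl : Defs.lem k l by move=> t; rewrite !ffunE.
  have wk : wt k = 0%N by rewrite /wt big1 // => t _; rewrite ffunE.
  have := B3_den_neq0 kl; rewrite /B3_den mulf_eq0 negb_or => /andP[+ _].
  rewrite qpfactE wk addn0 => /qf_factor_neq0 /(_ (wt_const _)).
  by rewrite exprD exprS !mulrA.
move=> k k_gt0; pose k0 : multi n := [ffun=> 0%N]; pose l : multi n := [ffun=> k].
have kl : Defs.lem k0 l by move=> t; rewrite !ffunE.
have := ratio_neq0 r0 r0 kl; rewrite !ffunE subn0 subr0 addr0 mulfK //.
move=> /(qf_factor_neq0 (i := k.-1)); rewrite prednK // => /(_ (leqnn _)).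
by rewrite expr1z -exprS prednK.
Qed.

Lemma rho_prod_neq0 : [/\ f != 0, bh != 0, ch != 0 & d != 0].
Proof. by rewrite !mulf_neq0 ?invr_eq0 ?mulf_neq0 ?expf_neq0. Qed.

Lemma box_formula_at :
  \sum_(k : box N | [forall r, j r <= k r]%N)
    box_term th q bh ch d z j N f g (fun r => k r - j r)%N = box_rhs th q bh ch z j N g.
Proof.
have [f0 bh0 ch0 d0] := rho_prod_neq0.
apply: (box_sum_formula (theta_theta_like p_lt1) q0 bh0 ch0 d0 jN string_generic_z f0).
  by rewrite mul2n -addnn exprS exprD; field; rewrite rho10 rho20.
by rewrite mulfVK.
Qed.

Section FixedIndex.
Variable k : multi n.
Hypotheses (jk : Defs.lem j k) (kN : Defs.lem k N).
Local Notation m r := (k r - j r)%N.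
Local Notation K := (wt k).

Lemma sum_m : (\sum_r m r = K - J)%N.
Proof. by rewrite /wt sumnB // => r _; apply: jk. Qed.

Lemma sum_M : (\sum_r M r = wt N - J)%N.
Proof. by rewrite /wt sumnB // => r _; apply: jN. Qed.

Lemma wt_jk : (J <= K)%N. Proof. by apply: leq_sum => r _; apply: jk. Qed.

Lemma wt_kN : (K <= wt N)%N. Proof. by apply: leq_sum => r _; apply: kN. Qed.

Lemma qpfacts2 y y' l : qpfacts q p [:: y; y'] l%:Z = qf th q y l * qf th q y' l.
Proof. by rewrite /qpfacts !big_cons big_nil mulr1. Qed.

Lemma qpow_m r : q ^+ (k r - j r) = q ^+ k r / q ^+ j r.
Proof. by rewrite -{2}(subnK (jk r)) exprD mulfK ?expf_neq0. Qed.

Lemma qpow_sum_m : q ^+ (\sum_r m r) = q ^+ K / q ^+ J.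
Proof. by rewrite sum_m -{2}(subnK wt_jk) exprD mulfK ?expf_neq0. Qed.

Let qN e : q ^+ e != 0. Proof. exact: expf_neq0. Qed.

Lemma numerator_split :
  \prod_(r < n) qpfacts q p [:: b * rho1 * x r / a; b * rho2 * x r / a] (N r)%:Z =
  beta'_den1 q p x rho1 rho2 k a b *
  \prod_r (qf th q (z r * q ^+ m r / bh) (M r - m r) * qf th q (z r * q ^+ m r / ch) (M r -
      m r)).
Proof.
rewrite /beta'_den1 -big_split /=; apply: eq_bigr => r _.
rewrite !qpfacts2 (_ : M r - m r = N r - k r)%N; last by have := jk r; have := kN r; lia.
rewrite -{1 2}(subnKC (kN r)) !qfD [LHS]mulrACA; congr (_ * _); rewrite mulrC.
congr (qf _ _ _ _ * qf _ _ _ _); rewrite qpow_m /shift_b exprS exprD; field.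
  by rewrite !qN rho10 a0 q0.
by rewrite !qN rho20 a0 q0.
Qed.

Lemma rho_split : qpfacts q p [:: rho1; rho2] K%:Z =
  qf th q rho1 J * qf th q rho2 J * (qf th q bh (\sum_r m r) * qf th q ch (\sum_r m r)).
Proof.
by rewrite qpfacts2 sum_m -{1 2}(subnKC wt_jk) !qfD mulrACA.
Qed.

Lemma f_factor : qpfact q p f ((wt N)%:Z - K%:Z) = qf th q f (\sum_r M r - \sum_r m r).
Proof.
by rewrite qpfact_sub ?wt_kN // sum_M sum_m; congr (qf _ _ _ _); have := wt_jk; have :=
    wt_kN; lia.
Qed.

Lemma ratio_z r s (e : int) : q ^ e * z r / z s = q ^ (e + (j r)%:Z - (j s)%:Z) * x r / x s.
Proof.
rewrite /= !expfzDr // -invr_expz -!exprnP !exprS !exprD /shift_b; field.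
by rewrite x0 !qN rho10 rho20 b0 a0 q0.
Qed.

Lemma den3_split : beta'_den3 q p x N k =
  \prod_r \prod_s qf th q (q ^ (1 + (m r)%:Z - (m s)%:Z) * z r / z s) (M r - m r).
Proof.
apply: eq_bigr => r _; apply: eq_bigr => s _; rewrite (qpfact_sub _ (kN r)) ratio_z.
have -> : (M r - m r = N r - k r)%N by have := jk r; have := kN r; lia.
have -> // : 1 + (m r)%:Z - (m s)%:Z + (j r)%:Z - (j s)%:Z = 1 + (k r)%:Z - (k s)%:Z.
by have := jk r; have := jk s; lia.
Qed.

Lemma bx_split : \prod_(r < n) qpfact q p (b * x r) (k r + wt N)%:Z =
  \prod_r qf th q (b * x r) (j r + wt N) * \prod_r qf th q (z r * d) (m r).
Proof.
rewrite -big_split; apply: eq_bigr => r _.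
rewrite qpfactE -{1}(subnKC (jk r)) addnAC qfD; congr (_ * qf _ _ _ _).
rewrite sum_M /shift_b -{1}(subnKC (leq_trans wt_jk wt_kN)) exprS !exprD; field.
by rewrite rho10 rho20 q0 a0.
Qed.

Lemma b'_split : \prod_(r < n) qpfact q p (b' * x r * q ^ ((j r)%:Z - J%:Z) / a) ((k r)%:Z
    - (j r)%:Z) =
  \prod_r qf th q (z r / g) (m r).
Proof.
apply: eq_bigr => r _; rewrite (qpfact_sub _ (jk r)); congr (qf th q _ _).
rewrite /= expfzDr // -invr_expz -!exprnP /shift_b !exprS mul2n -addnn !exprD; field.
by rewrite !qN a0 q0.
Qed.

(** Both sides come from splitting one factorial of length [K + N r + 1] that
    starts at [b' * x r]: once after its first factor, once into the pieces ending
    at [j r + K] and at [k r + K], the very-well-poised factor being the one in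
    between. *)
Lemma well_poised_split :
  (\prod_(r < n) th (b * rho1 * rho2 * x r * q ^+ (k r + K) / (a * q))) /
     beta'_den2 q p x rho1 rho2 a b *
  (\prod_(r < n) qpfact q p (b' * x r) (j r + K)%:Z) / beta'_den4 q p x rho1 rho2 N k a b =
  \prod_r (qf th q (z r * q ^+ (\sum_s m s) / q) (m r))^-1 *
  \prod_r (qf th q (z r * q ^+ m r * q ^+ (\sum_s m s)) (M r - m r))^-1.
Proof.
have [_ _ /prodf_neq0 d2 _ /prodf_neq0 d4] := Tgen kN.
rewrite /beta'_den2 /beta'_den4 -prodf_div -[X in X / _]big_split -prodf_div -[RHS]big_split.
apply: eq_bigr => r _.
have {}d2 := d2 r isT; have {}d4 := d4 r isT.
rewrite !qpfactE in d4 *; set y := b' * x r.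
have yE : b * rho1 * rho2 * x r / (a * q) = y by rewrite /y /shift_b; ring.
have yqE : b * rho1 * rho2 * x r / a = y * q by rewrite /y /shift_b; field; rewrite a0 q0.
rewrite yE in d2 *; rewrite yqE in d4 *.
have -> : b * rho1 * rho2 * x r * q ^+ (k r + K) / (a * q) = y * q ^+ (k r + K).
  by rewrite -yE; ring.
have -> : z r * q ^+ (\sum_s m s) / q = y * q ^+ (j r + K).
  by rewrite qpow_sum_m exprS !exprD /y; field; rewrite qN q0.
have -> : z r * q ^+ m r * q ^+ (\sum_s m s) = y * q ^+ (k r + K) * q.
  by rewrite qpow_sum_m qpow_m exprS !exprD /y; field; rewrite !qN.
have E : th y * qf th q (y * q) (K + N r) = qf th q y (j r + K) *
    (qf th q (y * q ^+ (j r + K)) (m r) * (th (y * q ^+ (k r + K)) *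
     qf th q (y * q ^+ (k r + K) * q) (M r - m r))).
  have kE : y * q ^+ (k r + K) = y * q ^+ (j r + K) * q ^+ m r.
    by rewrite qpow_m !exprD; field; rewrite qN.
  rewrite -qfS -qfS kE -qfD -qfD; congr (qf _ _ _ _).
  by have := jk r; have := kN r; lia.
have : th y * qf th q (y * q) (K + N r) != 0 by rewrite mulf_neq0.
rewrite E !mulf_eq0 !negb_or => /andP[n1 /andP[n2 /andP[n3 n4]]].
have -> : qf th q (y * q) (K + N r) = qf th q y (j r + K) *
    (qf th q (y * q ^+ (j r + K)) (m r) * (th (y * q ^+ (k r + K)) *
     qf th q (y * q ^+ (k r + K) * q) (M r - m r))) / th y.
  by rewrite -E [th y * _]mulrC mulfK.
by rewrite /=; field; rewrite d2 n1 n2 n3 n4.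
Qed.

Lemma B3_den_split : B3_den q p x N j a =
  B3_den q p x k j a * (qf th q (g * q ^+ (\sum_r m r)) (\sum_r M r - \sum_r m r) *
  \prod_r \prod_s qf th q (q ^+ (m r).+1 * z r / z s) (M r - m r)).
Proof.
rewrite /B3_den mulrACA; congr (_ * _).
  rewrite !qpfactE; have -> : (wt N + J = (K + J) + (\sum_r M r - \sum_r m r))%N.
    by rewrite sum_M sum_m; have := wt_jk; have := wt_kN; lia.
  rewrite qfD; congr (_ * qf _ _ _ _); rewrite qpow_sum_m mul2n -addnn exprS !exprD.
  by field; rewrite qN.
rewrite -big_split; apply: eq_bigr => r _; rewrite -big_split; apply: eq_bigr => s _.
rewrite (qpfact_sub _ (jN r)) (qpfact_sub _ (jk r)) [LHS](_ : _ = qf th q (q ^ (1 + (j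
    r)%:Z - (j s)%:Z) * x r / x s) (m r + (M r - m r))%N).
  2: by congr (qf th q _ _); have := jk r; have := kN r; lia.
rewrite qfD; congr (_ * qf th q _ _).
rewrite -[q ^+ (m r).+1 * _ / _]/(q ^ (m r).+1%:Z * z r / z s) ratio_z.
have -> : (m r).+1%:Z + (j r)%:Z - (j s)%:Z = 1 + (j r)%:Z - (j s)%:Z + (m r)%:Z by lia.
by rewrite [RHS]mulrAC -mulrA [in RHS]expfzDr // -exprnP; ring.
Qed.

(** The coefficient of [beta k] in the sum that defines [beta']. *)
Definition summand : R[i] :=
  qpfacts q p [:: rho1; rho2] K%:Z / beta'_den1 q p x rho1 rho2 k a b *
  ((\prod_(r < n) th (b * rho1 * rho2 * x r * q ^+ (k r + K) / (a * q))) /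
     beta'_den2 q p x rho1 rho2 a b) *
  (qpfact q p f ((wt N)%:Z - K%:Z) / beta'_den3 q p x N k) *
  ((\prod_(r < n) qpfact q p (b * x r) (k r + wt N)%:Z) /
     beta'_den4 q p x rho1 rho2 N k a b) * f ^+ K.

(** The part of the coefficient that depends on [k] is the term of the Jackson
    summation with [m = k - j]. *)
Lemma summand_box_term :
  (\prod_(r < n) qpfacts q p [:: b * rho1 * x r / a; b * rho2 * x r / a] (N r)%:Z) /
    outer_den q p rho1 rho2 N a * (summand * B3 q p x k j a b') =
  qf th q rho1 J * qf th q rho2 J * f ^+ J / outer_den q p rho1 rho2 N a *
    (\prod_r qf th q (b * x r) (j r + wt N)) / B3_den q p x N j a *
    box_term th q bh ch d z j N f g (fun r => m r).
Proof.
have [ho hd1 _ _ _] := Tgen kN.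
have hk0 := B3_den_neq0 jk; have hN0 := B3_den_neq0 jN.
rewrite B3_den_split in hN0 *.
have fK : f ^+ K = f ^+ J * f ^+ (\sum_r m r) by rewrite sum_m -exprD subnKC ?wt_jk.
have numE : B3_num q p x k j a b' = (\prod_(r < n) qpfact q p (b' * x r) (j r + K)%:Z) *
    \prod_r qf th q (z r / g) (m r) by rewrite -b'_split -big_split.
rewrite /summand /B3 numerator_split rho_split f_factor den3_split bx_split fK numE.
rewrite /box_term /subset_coef.
have inE : \prod_r (qf th q (z r * d) (m r) * qf th q (z r / g) (m r) /
    qf th q (z r * q ^+ (\sum_s m s) / q) (m r)) =
  \prod_r qf th q (z r * d) (m r) * \prod_r qf th q (z r / g) (m r) *
  \prod_r (qf th q (z r * q ^+ (\sum_s m s) / q) (m r))^-1 by rewrite -!big_split.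
have outE : \prod_r (qf th q (z r * q ^+ m r / bh) (M r - m r) *
    qf th q (z r * q ^+ m r / ch) (M r - m r) /
    qf th q (z r * q ^+ m r * q ^+ (\sum_s m s)) (M r - m r)) =
  \prod_r (qf th q (z r * q ^+ m r / bh) (M r - m r) * qf th q (z r * q ^+ m r / ch) (M r -
      m r)) *
  \prod_r (qf th q (z r * q ^+ m r * q ^+ (\sum_s m s)) (M r - m r))^-1 by rewrite -!big_split.
have crossE : \prod_r \prod_s (qf th q (q ^+ (m r).+1 * z r / z s) (M r - m r) /
    qf th q (q ^ (1 + (m r)%:Z - (m s)%:Z) * z r / z s) (M r - m r)) =
  (\prod_r \prod_s qf th q (q ^+ (m r).+1 * z r / z s) (M r - m r)) /
  \prod_r \prod_s qf th q (q ^ (1 + (m r)%:Z - (m s)%:Z) * z r / z s) (M r - m r).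
  by rewrite -prodf_div; apply: eq_bigr => r _; rewrite prodf_div.
rewrite inE outE crossE; have := well_poised_split.
move: hN0; rewrite !mulf_eq0 !negb_or => /and3P[_].
move: hk0 hd1; move: (B3_den _ _ _ _ _ _) (beta'_den1 _ _ _ _ _ _ _ _) => D1 D2 hk0 hd1.
move: (outer_den _ _ _ _ _ _)^-1 (beta'_den2 _ _ _ _ _ _ _)^-1 (beta'_den4 _ _ _ _ _ _ _ _
    _)^-1 => O T2 T4.
move: (\prod_r \prod_s qf th q (q ^ _ * _ / _) _)^-1 => D3.
move: (\prod_r (qf th q (z r * q ^+ (\sum_s m s) / q) (m r))^-1) => V1.
move: (\prod_r (qf th q (z r * q ^+ m r * q ^+ (\sum_s m s)) (M r - m r))^-1) => V2.
move: (\prod_r \prod_s qf th q _ _) => Q.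
move: (\prod_(r < n) qpfact q p (b' * x r) (j r + K)%:Z) => Bx.
move: (\prod_(r < n) th _) => T.
move: (\prod_r (qf th q (z r * q ^+ m r / bh) (M r - m r) * qf th q (z r * q ^+ m r / ch)
    (M r - m r))) => P.
move: (\prod_r qf th q (b * x r) (j r + wt N)) => B7.
move: (\prod_r qf th q (z r * d) (m r)) => Zd.
move: (\prod_r qf th q (z r / g) (m r)) => Zg.
move: (qf th q (g * _) _) => G G0 Q0 W.
transitivity (P * O * (qf th q rho1 J * qf th q rho2 J *
   (qf th q bh (\sum_r m r) * qf th q ch (\sum_r m r))) *
   (qf th q f (\sum_r M r - \sum_r m r) * D3) * (B7 * Zd) * (f ^+ J * f ^+ (\sum_r m r)) *
       Zg / D1 *
   (T * T2 * Bx * T4)).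
  move: (qf th q rho1 J) (qf th q rho2 J) (qf th q bh _) (qf th q ch _) (qf th q f _) (f ^+
      J) (f ^+ _) => r1 r2 r3 r4 r5 r6 r7.
  by field; rewrite hd1 hk0.
rewrite W.
move: (qf th q rho1 J) (qf th q rho2 J) (qf th q bh _) (qf th q ch _) (qf th q f _) (f ^+
    J) (f ^+ _) => r1 r2 r3 r4 r5 r6 r7.
by field; rewrite hk0 G0 Q0.
Qed.

End FixedIndex.
End Summand.

Lemma eq_box_sum (V : nmodType) (n : nat) (N : multi n) (G G' : multi n -> V) :
  (forall k, Defs.lem k N -> G k = G' k) -> box_sum N G = box_sum N G'.
Proof.
move=> e; apply: eq_bigr => k _; apply: e.
exact: (@box_val_le n N k).
Qed.

Lemma box_sumZ (K : pzRingType) (n : nat) (N : multi n) (c : K) (G : multi n -> K) :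
  c * box_sum N G = box_sum N (fun k => c * G k).
Proof. exact: mulr_sumr. Qed.

(** The value of the Jackson summation, with the prefactor of
    [summand_box_term], is the coefficient required of [B3] and [alpha']. *)
Lemma box_rhs_B3 (R : realType) (n : nat) (q p : R[i]) (x : 'I_n -> R[i])
    (rho1 rho2 a b : R[i]) (N j : multi n) :
  q != 0 -> rho1 != 0 -> rho2 != 0 -> a != 0 -> Defs.lem j N ->
  transf_generic q p x rho1 rho2 a b ->
  let f := a * q / (rho1 * rho2) in let J := wt j in
  qf (theta p) q rho1 J * qf (theta p) q rho2 J * f ^+ J / outer_den q p rho1 rho2 N a *
    (\prod_r qf (theta p) q (b * x r) (j r + wt N)) / B3_den q p x N j a *
    box_rhs (theta p) q (rho1 * q ^+ J) (rho2 * q ^+ J)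
      (fun r => shift_b q rho1 rho2 a b * q ^+ (J + j r).+1 * x r) j N (a * q ^+ (2 * J).+1) =
  B3 q p x N j a b *
    (qpfacts q p [:: rho1; rho2] J%:Z / outer_den q p rho1 rho2 j a * f ^+ J).
Proof.
move=> q0 r10 r20 a0 jN tgen f J.
have qN e : q ^+ e != 0 by apply: expf_neq0.
have JN : (J <= wt N)%N by apply: leq_sum => r _; apply: jN.
have sum_M : (\sum_r (N r - j r) = wt N - J)%N by rewrite /wt sumnB // => r _; apply: jN.
have [ho _ _ _ _] := tgen _ _ jN.
have outerE : outer_den q p rho1 rho2 N a = outer_den q p rho1 rho2 j a *
    (qf (theta p) q (a * q ^+ (2 * J).+1 / (rho1 * q ^+ J)) (\sum_r (N r - j r)) *
     qf (theta p) q (a * q ^+ (2 * J).+1 / (rho2 * q ^+ J)) (\sum_r (N r - j r))).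
  rewrite /outer_den !qpfacts2 sum_M -{1 2}(subnKC JN) !qfD mulrACA.
  congr (_ * (qf _ _ _ _ * qf _ _ _ _)); rewrite mul2n -addnn exprS exprD; field.
    by rewrite r10 qN.
  by rewrite r20 qN.
have numE : B3_num q p x N j a b = \prod_r qf (theta p) q (b * x r) (j r + wt N) *
    \prod_r qf (theta p) q (shift_b q rho1 rho2 a b * q ^+ (J + j r).+1 * x r /
      (rho1 * q ^+ J * (rho2 * q ^+ J))) (N r - j r).
  rewrite -big_split; apply: eq_bigr => r _; rewrite (qpfact_sub _ _ _ (jN r)).
  congr (_ * qf (theta p) q _ _); rewrite expfzDr // -invr_expz -!exprnP /shift_b exprS exprD.
  by field; rewrite r10 r20 a0 q0 !qN.
rewrite outerE in ho *; rewrite /B3 numE qpfacts2 /box_rhs.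
move: ho; rewrite !mulf_eq0 !negb_or => /and3P[].
move: (outer_den _ _ _ _ _ _) (B3_den _ _ _ _ _ _)^-1 (f ^+ J) => O DI fJ.
move: (\prod_r qf (theta p) q (b * x r) _) => Bx.
move: (\prod_r qf _ _ _ _) => P.
move: (qf _ _ _ (\sum_r _)%N) => G1.
move: (qf _ _ _ (\sum_r _)%N) => G2.
move: (qf _ _ rho1 _) (qf _ _ rho2 _) => r1 r2 O0 G10 G20.
by field; rewrite O0 G10 G20.
Qed.

Theorem theorem5p10 (R : realType) (n : nat) (q p : R[i]) (x : 'I_n -> R[i])
    (rho1 rho2 : R[i]) (D : R[i] -> R[i] -> Prop) (alpha beta : seq_ab R n) :
  (1 <= n)%N ->
  q != 0 -> `|p| < 1 ->
  (forall r : 'I_n, x r != 0) ->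
  rho1 != 0 -> rho2 != 0 ->
  WP_Bailey_pair (B3 q p x)
    (fun a b : R[i] => B3_generic q p x a b /\ D a b)
    alpha beta ->
  WP_Bailey_pair (B3 q p x)
    (fun a b : R[i] =>
      [/\ B3_generic q p x a b,
          transf_generic q p x rho1 rho2 a b
        & D a (shift_b q rho1 rho2 a b)])
    (alpha' q p rho1 rho2 alpha)
    (beta' q p x rho1 rho2 beta).
Proof.
move=> n_gt0 q0 p_lt1 x0 r10 r20 pairD N a b [gen tgen Dab].
have [a0 b0 hden] := gen.
set b' := shift_b q rho1 rho2 a b in Dab *.
have b'0 : b' != 0 by rewrite /b' /shift_b !mulf_neq0 ?invr_eq0 ?mulf_neq0.
have gen' : B3_generic q p x a b' by split.
rewrite /beta' box_sumZ.
transitivity (box_sum N (fun k => box_sum k (fun j =>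
    (\prod_(r < n) qpfacts q p [:: b * rho1 * x r / a; b * rho2 * x r / a] (N r)%:Z) /
      outer_den q p rho1 rho2 N a *
    (summand q p x rho1 rho2 a b N k * B3 q p x k j a b') * alpha j a b'))).
  apply: eq_box_sum => k kN; rewrite (pairD k a b') //.
  rewrite -/(summand q p x rho1 rho2 a b N k) !box_sumZ.
  by apply: eq_box_sum => j _; rewrite !mulrA.
rewrite box_sum_exchange; apply: eq_bigr => j _.
rewrite -/(box_val j); have jN := @box_val_le n N j.
rewrite -mulr_suml /alpha' -/b'.
rewrite [RHS]mulrA; congr (_ * _).
rewrite -(box_rhs_B3 q0 r10 r20 a0 jN tgen).
rewrite -(box_formula_at n_gt0 q0 p_lt1 x0 r10 r20 gen tgen jN) mulr_sumr.
apply: eq_big => [k|k /forallP jk]; first by apply: eq_forallb => r; rewrite box_valE.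
have jk' : Defs.lem (box_val j) (box_val k) by move=> r; rewrite !box_valE.
rewrite (summand_box_term n_gt0 q0 p_lt1 x0 r10 r20 gen tgen jN jk' (@box_val_le n N k)).
by congr (_ * box_term _ _ _ _ _ _ _ _ _ _ _); apply/funext => r; rewrite box_valE.
Qed.
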